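(* Let $\hat\rho_{AE}$ be a quantum state on finite-dimensional Hilbert spaces $\mathcal H_A\otimes\mathcal H_E$. Then for any $0<\delta\le\varepsilon$, catalytic decoupling of $A$ from $E$ with error $\varepsilon$ can be achieved with remainder system size $$ \log|A_2| \le \frac12\Big(I_{\max}^{\varepsilon-\delta}(E:A)_{\hat\rho}+\big\{\log\log I_{\max}^{\varepsilon-\delta}(E:A)_{\hat\rho}\big\}_+\Big)+\mathcal O\big(\log\tfrac1\delta\big), $$ where $\{x\}_+=x$ if $x\in\mathbb R_{\ge0}$ and $\{x\}_+=0$ otherwise (including when $x$ is not defined as a real number). The constant implied by $\mathcal O(\log\frac1\delta)$ (as $\delta\to0$) is absolute, i.e. independent of the state, the dimensions and $\varepsilon$.
   Context: Logarithms are base 2; all Hilbert spaces are finite-dimensional; $|X|=\dim\mathcal H_X$. A subnormalized state is a positive semidefinite operator of trace at most 1. For subnormalized states, $F(\rho,\sigma)=\|\sqrt\rho\sqrt\sigma\|_1+\sqrt{(1-\mathrm{tr}\rho)(1-\mathrm{tr}\sigma)}$ and $P(\rho,\sigma)=\sqrt{1-F(\rho,\sigma)^2}$ (purified distance). $B_\varepsilon(\rho)$ is the set of subnormalized states within purified distance $\varepsilon$ of $\rho$. $D_{\max}(\rho\|\sigma)=\min\{\lambda\in\mathbb R:2^\lambda\sigma\ge\rho\}$; $I_{\max}(E:A)_{\bar\rho}=\min_{\sigma_A}D_{\max}(\bar\rho_{AE}\|\sigma_A\otimes\bar\rho_E)$, minimum over normalized states $\sigma_A$; $I_{\max}^{\varepsilon}(E:A)_\rho=\min_{\bar\rho\in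 B_\varepsilon(\rho_{AE})}I_{\max}(E:A)_{\bar\rho}$. Catalytic decoupling of $A$ from $E$ in $\hat\rho_{AE}$ with error $\varepsilon$ and remainder system size $\log|A_2|$ is achieved if there are a finite-dimensional ancilla system $A'$ with a state $\sigma_{A'}$, a decomposition $\mathcal H_A\otimes\mathcal H_{A'}\cong\mathcal H_{A_1}\otimes\mathcal H_{A_2}$, a unitary $U$ on $\mathcal H_A\otimes\mathcal H_{A'}$, and states $\omega_{A_1},\omega_E$ such that $P\big(\mathrm{tr}_{A_2}[U(\hat\rho_{AE}\otimes\sigma_{A'})U^\dagger],\ \omega_{A_1}\otimes\omega_E\big)\le\varepsilon$. *)

(* Defs.v *)
From HB Require Import structures.
From mathcomp Require Import all_boot all_order all_algebra.
From mathcomp Require Import all_classical all_reals all_analysis.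
From mathcomp Require Import spectral sesquilinear.
From mathcomp Require Export complex mxtens.

Set Implicit Arguments.
Unset Strict Implicit.
Unset Printing Implicit Defensive.

Import Order.TTheory GRing.Theory Num.Theory.
Import numFieldNormedType.Exports.

Local Open Scope classical_set_scope.
Local Open Scope ring_scope.
Local Open Scope complex_scope.
Local Open Scope sesquilinear_scope.

(* A Hilbert space of dimension n is C^n with its standard basis; operators are
   matrices over R[i]. The tensor product of C^m and C^n is C^(m * n), the basis
   vector e_i (x) e_j having index [mxtens_index (i, j)], so that [*t] (Kronecker
   product) is the tensor product of operators. *)

Section Operators.
Variable R : realType.
Local Notation C := R[i].

Definition log2 (x : R) : R := ln x / ln 2.

(* In R[i], [0 <= z] means that z is real and nonnegative. *)
Definition psdmx n (A : 'M[C]_n) : Prop :=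
  A \is hermsymmx /\ forall v : 'rV[C]_n, 0 <= (v *m A *m v^t*) 0 0.

Definition lownermx n (A B : 'M[C]_n) : Prop := psdmx (B - A).

Definition substate n (A : 'M[C]_n) : Prop := psdmx A /\ \tr A <= 1.

Definition state n (A : 'M[C]_n) : Prop := psdmx A /\ \tr A = 1.

(* Square root by functional calculus; meant for positive semidefinite A, whose
   spectral decomposition is
   A = invmx (spectralmx A) *m diag_mx (spectral_diag A) *m spectralmx A. *)
Definition sqrtmx n (A : 'M[C]_n) : 'M[C]_n :=
  invmx (spectralmx A) *m diag_mx (map_mx sqrtC (spectral_diag A))
    *m spectralmx A.

Definition trnorm n (A : 'M[C]_n) : R := complex.Re (\tr (sqrtmx (A^t* *m A))).

Definition fidelity n (rho sigma : 'M[C]_n) : R :=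
  trnorm (sqrtmx rho *m sqrtmx sigma) +
  Num.sqrt ((1 - complex.Re (\tr rho)) * (1 - complex.Re (\tr sigma))).

Definition purified_dist n (rho sigma : 'M[C]_n) : R :=
  Num.sqrt (1 - fidelity rho sigma ^+ 2).

Definition purified_ball n (eps : R) (rho : 'M[C]_n) : set 'M[C]_n :=
  [set rhob | substate rhob /\ purified_dist rho rhob <= eps].

Definition ptrace1 m n (A : 'M[C]_(m * n)) : 'M[C]_n :=
  \matrix_(i, j) \sum_k A (mxtens_index (k, i)) (mxtens_index (k, j)).

(* From systems (A1 (x) A2) (x) E to A1 (x) E. *)
Definition ptrace_mid m p n (A : 'M[C]_((m * p) * n)) : 'M[C]_(m * n) :=
  \matrix_(i, j)
    let: (a, e) := mxtens_unindex i in
    let: (b, f) := mxtens_unindex j in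
    \sum_k A (mxtens_index (mxtens_index (a, k), e))
             (mxtens_index (mxtens_index (b, k), f)).

(* rho_AE (x) sigma_A', with the systems reordered as (A (x) A') (x) E. *)
Definition add_ancilla dA dE dA' (rho : 'M[C]_(dA * dE)) (sigma : 'M[C]_dA') :
    'M[C]_((dA * dA') * dE) :=
  \matrix_(i, j)
    let: (aa', e) := mxtens_unindex i in
    let: (bb', f) := mxtens_unindex j in
    let: (a, a') := mxtens_unindex aa' in
    let: (b, b') := mxtens_unindex bb' in
    rho (mxtens_index (a, e)) (mxtens_index (b, f)) * sigma a' b'.

(* The minima defining D_max, I_max and its smoothing are taken as infima in the
   extended reals, so that D_max = +oo when no lambda is admissible. *)
Definition Dmax n (rho sigma : 'M[C]_n) : \bar R :=
  ereal_inf [set l%:E | l in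
    [set l : R | lownermx rho (((2 `^ l)%:C) *: sigma)]].

Definition Imax dA dE (rho : 'M[C]_(dA * dE)) : \bar R :=
  ereal_inf [set Dmax rho (sigma *t ptrace1 rho) | sigma in
    [set sigma : 'M[C]_dA | state sigma]].

(* For a normalized rho and eps < 1 the infimum is finite: it is nonnegative, as
   0 is not in the ball, and at most [Dmax rho ((dA%:R^-1)%:M *t ptrace1 rho)],
   which is finite. For eps >= 1 the ball contains 0, for which the set defining
   D_max is all of R and has no minimum; the value of [fine] is then 0. *)
Definition smooth_Imax dA dE (eps : R) (rho : 'M[C]_(dA * dE)) : R :=
  fine (ereal_inf [set Imax rhob | rhob in purified_ball eps rho]).

(* {log log x}_+ ; log (log x) is a real number exactly when 1 < x. *)
Definition loglog_pos (x : R) : R :=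
  if 1 < x then Num.max (log2 (log2 x)) 0 else 0.

(* d2 = |A2|. V is the isomorphism of A (x) A' with A1 (x) A2. *)
Definition catalytic_decoupling dA dE (rho : 'M[C]_(dA * dE)) (eps : R)
    (d2 : nat) : Prop :=
  exists (dA' d1 : nat) (sigma : 'M[C]_dA') (V : 'M[C]_(d1 * d2, dA * dA'))
         (U : 'M[C]_(dA * dA')) (omega1 : 'M[C]_d1) (omegaE : 'M[C]_dE),
    let W := (V *m U) *t (1%:M : 'M[C]_dE) in
    [/\ state sigma,
        V \is unitarymx /\ V^t* \is unitarymx,
        U \is unitarymx,
        state omega1 /\ state omegaE &
        purified_dist (ptrace_mid (W *m add_ancilla rho sigma *m W^t*))
                      (omega1 *t omegaE) <= eps].

End Operators.

(* Main.v *)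
Require Import Defs.
From mathcomp Require Import all_boot all_order all_algebra.
From mathcomp Require Import all_classical all_reals all_analysis.
From mathcomp Require Import spectral sesquilinear ring lra.

(* Convex splitting: let [tau] be a state near [rho] with
   [tau <= K (sigma (x) tau_E)]. Adjoin [n] copies of [sigma] and average over
   the [n] unitaries that swap [A] with one of the copies. The result has
   collision divergence [Q <= 1 + K / n] relative to
   [sigma ^ (n + 1) (x) tau_E], and the purified distance is at most
   [sqrt (Q - 1)]. The averaging is done by a catalyst: the swap is controlled by
   an index in a maximally mixed register of dimension [n = d ^ 2]. Rotating the
   index basis to a basis of maximally entangled vectors of [C^d (x) C^d],
   discarding one factor of dimension [d] erases the index, so that
   [log d = (log K) / 2 + log (1 / q)] suffices for error [q]. Since the fidelity
   is attained on, and bounded below by, overlaps of purifications, it is monotone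
   under the channel and satisfies the triangle inequality, which gives the
   smoothing; a subnormalized state in the ball may be normalized first. No
   doubly logarithmic term arises. *)

Set Implicit Arguments.
Unset Strict Implicit.
Unset Printing Implicit Defensive.

Import Order.TTheory GRing.Theory Num.Theory.

Local Open Scope ring_scope.
Local Open Scope sesquilinear_scope.

(** * Fidelity of positive semidefinite matrices *)

Section Matrices.
Variable C : numClosedFieldType.

(** Second moments are used because they can be computed exactly for the averaged state: each pair
    of distinct terms contributes exactly 1, and only the [n] pairs of equal terms cost [K]. The
    computation inverts the reference state entrywise, so [sigma] and [tau_E] are diagonalized by
    local unitaries, which the notion of catalytic decoupling absorbs. Zero weights are harmless:
    domination makes the matching entries of the state vanish, and [0^-1 = 0]. The factor 1/2 is
    superdense coding read as erasure: [d^2] orthonormal vectors share one maximally mixed marginal,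
    so removing [d] dimensions hides [d^2] indices. Bell vectors labelled by bit strings make [d] a
    power of two, which costs at most one bit; choosing a smoothed state within 1 of the infimum
    costs half a bit. *)

Lemma adjmx_mul m n p (A : 'M[C]_(m, n)) (B : 'M[C]_(n, p)) :
  (A *m B)^t* = B^t* *m A^t*.
Proof. by rewrite trmx_mul map_mxM. Qed.

Lemma adjmx_diag n (d : 'rV[C]_n) : (diag_mx d)^t* = diag_mx (map_mx Num.conj d).
Proof. by rewrite tr_diag_mx map_diag_mx. Qed.

Lemma adjmx_sub m n (A B : 'M[C]_(m, n)) : (A - B)^t* = A^t* - B^t*.
Proof. by apply/matrixP => i j; rewrite !mxE rmorphB. Qed.

Lemma adjmx1 n : (1%:M : 'M[C]_n)^t* = 1%:M.
Proof. by rewrite trmx1 map_mx1. Qed.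

Lemma hermsymmxP n (A : 'M[C]_n) : reflect (A^t* = A) (A \is hermsymmx).
Proof.
apply: (iffP (is_hermitianmxP _ _ _)); rewrite expr0 scale1r; first by move=> <-.
by move=> ->.
Qed.

(** Summing [|Y x_i - c y_i^*|^2] over [i] gives [Y (X Y - |c|^2)], which is therefore
    nonnegative. *)
Lemma CauchySchwarz_sum (I : finType) (x y : I -> C) :
  `|\sum_i x i * y i| ^+ 2 <= (\sum_i `|x i| ^+ 2) * (\sum_i `|y i| ^+ 2).
Proof.
set c := \sum_i _; set X := \sum_i `|x i| ^+ 2; set Y := \sum_i `|y i| ^+ 2.
have Y0 : 0 <= Y by apply: sumr_ge0 => i _; rewrite exprn_ge0.
have [Yz|Yn0] := eqVneq Y 0.
  have y0 i : y i = 0.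
    have /psumr_eq0P := Yz; move=> /(_ (fun i _ => exprn_ge0 2 (normr_ge0 _))).
    by move=> /(_ i isT)/eqP; rewrite expf_eq0 /= normr_eq0 => /eqP.
  by rewrite /c big1 ?normr0 ?expr0n ?Yz ?mulr0 // => i _; rewrite y0 mulr0.
have Ypos : 0 < Y by rewrite lt_def Yn0.
rewrite -(ler_pM2l Ypos) -subr_ge0.
have -> : Y * (X * Y) - Y * `|c| ^+ 2 = \sum_i `|Y * x i - c * (y i)^*| ^+ 2.
  have e i : `|Y * x i - c * (y i)^*| ^+ 2 =
     Y ^+ 2 * `|x i| ^+ 2 - Y * c^* * (x i * y i) - Y * c * (x i * y i)^*
     + `|c| ^+ 2 * `|y i| ^+ 2.
    rewrite !normCK !(rmorphB, rmorphM) /= conjCK (CrealP (ger0_real Y0)).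
    by ring.
  under [RHS]eq_bigr do rewrite e.
  rewrite !(big_split, sumrN) /= -!mulr_sumr -rmorph_sum /= -/c -/X -/Y normCK.
  by ring.
by apply: sumr_ge0 => i _; rewrite exprn_ge0.
Qed.

Lemma mxtrace_adjmulE m n (M N : 'M[C]_(m, n)) :
  \tr (M^t* *m N) = \sum_i \sum_j (M i j)^* * N i j.
Proof.
rewrite exchange_big /=; apply: eq_bigr => j _; rewrite mxE.
by apply: eq_bigr => i _; rewrite !mxE.
Qed.

Lemma mxtrace_gramE m n (M : 'M[C]_(m, n)) :
  \tr (M *m M^t*) = \sum_i \sum_j `|M i j| ^+ 2.
Proof.
rewrite mxtrace_mulC mxtrace_adjmulE; apply: eq_bigr => i _.
by apply: eq_bigr => j _; rewrite normCK mulrC.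
Qed.

Lemma mxtrace_gram_ge0 m n (M : 'M[C]_(m, n)) : 0 <= \tr (M *m M^t*).
Proof.
by rewrite mxtrace_gramE; do 2!apply: sumr_ge0 => ? _; rewrite exprn_ge0.
Qed.

Lemma mxtrace_gram_eq0 m n (M : 'M[C]_(m, n)) : \tr (M *m M^t*) = 0 -> M = 0.
Proof.
rewrite mxtrace_gramE pair_big /= => /psumr_eq0P z; apply/matrixP => i j.
have/(_ (fun p _ => exprn_ge0 2 (normr_ge0 _)) (i, j) isT)/eqP := z.
by rewrite expf_eq0 /= normr_eq0 mxE => /eqP.
Qed.

Lemma gram_eq0 m n (M : 'M[C]_(m, n)) : M *m M^t* = 0 -> M = 0.
Proof. by move=> h; apply: mxtrace_gram_eq0; rewrite h mxtrace0. Qed.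

Lemma mxtrace_CauchySchwarz m n (M N : 'M[C]_(m, n)) :
  `|\tr (M^t* *m N)| ^+ 2 <= \tr (M *m M^t*) * \tr (N *m N^t*).
Proof.
rewrite mxtrace_adjmulE !mxtrace_gramE !pair_big /=.
have := CauchySchwarz_sum (fun p : 'I_m * 'I_n => (M p.1 p.2)^*) (fun p => N p.1 p.2).
by under [in X in _ <= X * _ -> _]eq_bigr do rewrite norm_conjC.
Qed.

Lemma mxtrace11 (A : 'M[C]_1) : \tr A = A 0 0.
Proof. exact: trace_mx11. Qed.

(* [psdmx] over an arbitrary closed field; the two are convertible over [R[i]]. *)
Definition psd n (A : 'M[C]_n) : Prop :=
  A \is hermsymmx /\ forall v : 'rV[C]_n, 0 <= (v *m A *m v^t*) 0 0.

Lemma psd_adj n (A : 'M[C]_n) : psd A -> A^t* = A.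
Proof. by case=> /hermsymmxP. Qed.

Lemma psd_gram m n (M : 'M[C]_(m, n)) : psd (M *m M^t*).
Proof.
split; first by apply/hermsymmxP; rewrite adjmx_mul trmxCK.
by move=> v; rewrite mulmxA -mulmxA -adjmx_mul -mxtrace11 mxtrace_gram_ge0.
Qed.

Lemma psd_conj m n (X : 'M[C]_(m, n)) (A : 'M[C]_n) : psd A -> psd (X *m A *m X^t*).
Proof.
move=> [/hermsymmxP hA pA]; split.
  by apply/hermsymmxP; rewrite !adjmx_mul trmxCK hA mulmxA.
move=> v; have := pA (v *m X).
by rewrite adjmx_mul !mulmxA.
Qed.

Lemma psd_diag_ge0 n (A : 'M[C]_n) i : psd A -> 0 <= A i i.
Proof.
move=> [_ /(_ (delta_mx 0 i))]; rewrite -rowE !mxE.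
by rewrite (bigD1 i) //= big1 ?addr0 ?mxE ?eqxx ?rmorph1 ?mulr1 // => j /negbTE ne;
  rewrite !mxE eqxx /= ne rmorph0 mulr0.
Qed.

Lemma psd_trace_ge0 n (A : 'M[C]_n) : psd A -> 0 <= \tr A.
Proof. by move=> pA; apply: sumr_ge0 => i _; exact: psd_diag_ge0. Qed.

(* Locked, because failed unification of two instances would unfold [spectralmx]. *)
Fact fcalc_key : unit. Proof. by []. Qed.
Definition fcalc n (f : C -> C) (A : 'M[C]_n) : 'M[C]_n :=
  locked_with fcalc_key
    ((spectralmx A)^t* *m diag_mx (map_mx f (spectral_diag A)) *m spectralmx A).

Lemma fcalcE n f (A : 'M[C]_n) :
  fcalc f A = (spectralmx A)^t* *m diag_mx (map_mx f (spectral_diag A)) *m spectralmx A.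
Proof. exact: unlock. Qed.

Lemma spectralmx_mul_adj n (A : 'M[C]_n) : spectralmx A *m (spectralmx A)^t* = 1%:M.
Proof. exact/unitarymxP/spectral_unitarymx. Qed.

Lemma spectralmx_adj_mul n (A : 'M[C]_n) : (spectralmx A)^t* *m spectralmx A = 1%:M.
Proof. exact/mulmx1C/spectralmx_mul_adj. Qed.

Lemma fcalcM n f g (A : 'M[C]_n) :
  fcalc f A *m fcalc g A = fcalc (fun x => f x * g x) A.
Proof.
rewrite !fcalcE !mulmxA -[_ *m spectralmx A *m _]mulmxA spectralmx_mul_adj mulmx1.
rewrite -[_ *m diag_mx _ *m diag_mx _]mulmxA mulmx_diag.
by congr (_ *m diag_mx _ *m _); apply/rowP => i; rewrite !mxE.
Qed.

Lemma fcalc_adj n f (A : 'M[C]_n) : (fcalc f A)^t* = fcalc (fun x => (f x)^*) A.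
Proof.
rewrite !fcalcE !adjmx_mul trmxCK adjmx_diag mulmxA.
by congr (_ *m diag_mx _ *m _); apply/rowP => i; rewrite !mxE.
Qed.

Lemma eq_fcalc n f g (A : 'M[C]_n) :
  (forall i, f (spectral_diag A 0 i) = g (spectral_diag A 0 i)) -> fcalc f A = fcalc g A.
Proof. by move=> e; rewrite !fcalcE; congr (_ *m diag_mx _ *m _); apply/rowP => i; rewrite !mxE. Qed.

Lemma fcalc_id n (A : 'M[C]_n) : A^t* = A -> fcalc id A = A.
Proof.
move=> /hermsymmxP hA; have /orthomx_spectralP e := hermitian_normalmx hA.
rewrite [RHS]e.
rewrite invmx_unitary ?spectral_unitarymx // fcalcE.
by congr (_ *m diag_mx _ *m _); apply/rowP => i; rewrite mxE.
Qed.

(** Lets a scalar inequality on the eigenvalues of [A] be averaged with the diagonal weights of [K]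
    in the eigenbasis of [A]. *)
Lemma mxtrace_mul_fcalc n f (K A : 'M[C]_n) :
  \tr (K *m fcalc f A) =
  \sum_i (spectralmx A *m K *m (spectralmx A)^t*) i i * f (spectral_diag A 0 i).
Proof.
rewrite !fcalcE !mulmxA mxtrace_mulC !mulmxA; apply: eq_bigr => i _.
rewrite mxE (bigD1 i) //= big1 ?addr0 ?mxE ?eqxx ?mulr1n // => j ne.
by rewrite !mxE (negbTE ne) mulr0n mulr0.
Qed.

Lemma mxtrace_fcalc n f (A : 'M[C]_n) : \tr (fcalc f A) = \sum_i f (spectral_diag A 0 i).
Proof.
rewrite -[fcalc f A]mul1mx mxtrace_mul_fcalc; apply: eq_bigr => i _.
by rewrite mulmx1 spectralmx_mul_adj mxE eqxx mul1r.
Qed.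

Lemma spectralmx_conj n (A : 'M[C]_n) : A^t* = A ->
  spectralmx A *m A *m (spectralmx A)^t* = diag_mx (spectral_diag A).
Proof.
move=> /fcalc_id; rewrite fcalcE; set Q := spectralmx A => e.
rewrite -{1}e !mulmxA spectralmx_mul_adj mul1mx -mulmxA spectralmx_mul_adj mulmx1.
by congr diag_mx; apply/rowP => i; rewrite mxE.
Qed.

Lemma spectral_diagE n (A : 'M[C]_n) i : A^t* = A ->
  spectral_diag A 0 i = (spectralmx A *m A *m (spectralmx A)^t*) i i.
Proof. by move=> aA; rewrite (spectralmx_conj aA) mxE eqxx mulr1n. Qed.

Lemma psd_spectral_ge0 n (A : 'M[C]_n) i : psd A -> 0 <= spectral_diag A 0 i.
Proof.
move=> pA; rewrite (spectral_diagE _ (psd_adj pA)).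
exact: psd_diag_ge0 (psd_conj _ pA).
Qed.

Lemma fcalc_sqrt_adj n (A : 'M[C]_n) : psd A -> (fcalc sqrtC A)^t* = fcalc sqrtC A.
Proof.
move=> pA; rewrite fcalc_adj; apply: eq_fcalc => i.
by apply/CrealP/ger0_real; rewrite sqrtC_ge0 psd_spectral_ge0.
Qed.

Lemma fcalc_sqrtK n (A : 'M[C]_n) : psd A -> fcalc sqrtC A *m fcalc sqrtC A = A.
Proof.
move=> pA; rewrite fcalcM -[RHS](fcalc_id (psd_adj pA)).
by apply: eq_fcalc => i; rewrite -expr2 sqrtCK.
Qed.

Definition tnorm n (A : 'M[C]_n) : C :=
  locked_with fcalc_key (\tr (fcalc sqrtC (A^t* *m A))).

Lemma tnormE n (A : 'M[C]_n) : tnorm A = \tr (fcalc sqrtC (A^t* *m A)).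
Proof. exact: unlock. Qed.

Lemma psd_adjmul m n (A : 'M[C]_(m, n)) : psd (A^t* *m A).
Proof. by rewrite -{2}[A]trmxCK; apply: psd_gram. Qed.

Lemma tnorm_ge0 n (A : 'M[C]_n) : 0 <= tnorm A.
Proof.
rewrite tnormE mxtrace_fcalc sumr_ge0 // => i _.
by rewrite sqrtC_ge0; apply/psd_spectral_ge0/psd_adjmul.
Qed.

Lemma idempotent_compl n (E : 'M[C]_n) :
  E *m E = E -> (1%:M - E) *m (1%:M - E) = 1%:M - E.
Proof. by move=> EE; rewrite mulmxBr mulmx1 mulmxBl mul1mx EE subrr subr0. Qed.

Definition contraction m n (K : 'M[C]_(m, n)) :=
  forall v : 'rV[C]_m, \tr (v *m K *m (v *m K)^t*) <= \tr (v *m v^t*).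

Lemma contraction_mul m n p (K : 'M[C]_(m, n)) (L : 'M[C]_(n, p)) :
  contraction K -> contraction L -> contraction (K *m L).
Proof.
move=> hK hL v; rewrite mulmxA.
by rewrite (le_trans (hL _)) ?hK.
Qed.

(** [Y Y^*] is a projection [E], and [|v|^2 = |v Y|^2 + |v (1 - E)|^2]. *)
Lemma partial_isometry_contraction m n (Y : 'M[C]_(m, n)) :
  Y *m Y^t* *m Y = Y -> contraction Y.
Proof.
move=> hY v; set E := Y *m Y^t*.
have EE : E *m E = E by rewrite /E mulmxA hY.
have adjE : E^t* = E by rewrite adjmx_mul trmxCK.
have -> : v *m v^t* = v *m Y *m (v *m Y)^t* + (v *m (1%:M - E)) *m (v *m (1%:M - E))^t*.
  rewrite !adjmx_mul adjmx_sub adjmx1 adjE.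
  rewrite !mulmxA -[v *m Y *m _]mulmxA -/E -[_ *m (_ - _) *m (_ - _)]mulmxA.
  rewrite (idempotent_compl EE) -mulmxDl -mulmxDr.
  by rewrite addrC subrK mulmx1.
by rewrite linearD lerDl mxtrace_gram_ge0.
Qed.

Lemma partial_isometry_adj m n (Y : 'M[C]_(m, n)) :
  Y *m Y^t* *m Y = Y -> Y^t* *m Y^t*^t* *m Y^t* = Y^t*.
Proof. by move=> h; rewrite -{4}h !adjmx_mul !trmxCK mulmxA. Qed.

Lemma diag_mul_adj m n (X Y : 'M[C]_(m, n)) i :
  (X *m Y^t*) i i = \tr (row i X *m (row i Y)^t*).
Proof. by rewrite mxtrace11 !mxE; apply: eq_bigr => j _; rewrite !mxE. Qed.

(** In an eigenbasis [Q] of [A^* A], each diagonal entry is the inner product of a row of [Q K], of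
    norm at most 1, with a row of [Q A^*], whose squared norm is the eigenvalue. Cauchy-Schwarz
    bounds the entry by the singular value. *)
Lemma contraction_trace_le n (K A : 'M[C]_n) : contraction K -> `|\tr (K *m A)| <= tnorm A.
Proof.
move=> hK; set B := A^t* *m A; set Q := spectralmx B.
have -> : \tr (K *m A) = \sum_i \tr ((row i (Q *m K)) *m (row i (Q *m A^t*))^t*).
  rewrite -[LHS]mulr1 -[K *m A]mulmx1 -(spectralmx_adj_mul B) -/Q mulr1.
  rewrite mulmxA mxtrace_mulC !mulmxA -[_ *m A *m _]mulmxA.
  rewrite -{1}[A]trmxCK -adjmx_mul; apply: eq_bigr => i _; exact: diag_mul_adj.
rewrite tnormE mxtrace_fcalc (le_trans (ler_norm_sum _ _ _)) // ler_sum // => i _.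
have psdB := psd_adjmul A.
rewrite -(@ler_pXn2r _ 2) ?nnegrE ?sqrtC_ge0 ?psd_spectral_ge0 // sqrtCK.
rewrite mxtrace_mulC (le_trans (mxtrace_CauchySchwarz _ _)) //.
rewrite (spectral_diagE _ (psd_adj psdB)) -/B -/Q.
have -> : (Q *m B *m Q^t*) i i = \tr (row i (Q *m A^t*) *m (row i (Q *m A^t*))^t*).
  by rewrite -diag_mul_adj adjmx_mul trmxCK !mulmxA.
rewrite ler_piMr ?mxtrace_gram_ge0 //.
rewrite row_mul (le_trans (hK _)) //.
by rewrite -diag_mul_adj spectralmx_mul_adj mxE eqxx.
Qed.

(** As [0^-1 = 0], functional calculus with it yields the pseudo-inverse of the square root. *)
Definition invsqrt (x : C) := (sqrtC x)^-1.

(** Polar decomposition: [Y] is the pseudo-inverse of the square root of [M M^*], applied to [M]. *)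
Lemma gram_polar m n (M : 'M[C]_(m, n)) (A := M *m M^t*) :
  exists2 Y : 'M[C]_(m, n), M = fcalc sqrtC A *m Y & Y *m Y^t* *m Y = Y.
Proof.
have pA : psd A := psd_gram M.
have aA : A^t* = A := psd_adj pA.
have ge0 i : 0 <= spectral_diag A 0 i := psd_spectral_ge0 i pA.
pose J := fcalc invsqrt A.
have aJ : J^t* = J.
  rewrite /J fcalc_adj; apply: eq_fcalc => i.
  by apply/CrealP; rewrite /invsqrt ger0_real // invr_ge0 sqrtC_ge0.
pose P := fcalc (fun x => sqrtC x * invsqrt x) A.
have aP : P^t* = P.
  rewrite /P fcalc_adj; apply: eq_fcalc => i.
  by apply/CrealP; rewrite /invsqrt ger0_real // mulr_ge0 ?invr_ge0 ?sqrtC_ge0.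
(* [P] is the support projection of [A = M M^*]; since [(P - 1) M M^* = 0], the Gram matrix of
   [(P - 1) M] vanishes. *)
have PM : P *m M = M.
  apply/eqP; rewrite -subr_eq0 -{2}[M]mul1mx -mulmxBl; apply/eqP/gram_eq0.
  rewrite adjmx_mul mulmxA -[_ *m M *m _]mulmxA -/A.
  rewrite mulmxBl mul1mx -{1 2}[A](fcalc_id aA) /P fcalcM.
  have -> : fcalc (fun x => sqrtC x * invsqrt x * x) A = fcalc id A.
    apply: eq_fcalc => i; rewrite /invsqrt /=; set x := spectral_diag A 0 i.
    have [->|nz] := eqVneq x 0; first by rewrite mulr0.
    by rewrite divff ?mul1r // sqrtC_eq0.
  by rewrite subrr mul0mx.
exists (J *m M); first by rewrite mulmxA fcalcM PM.
have -> : J *m M *m (J *m M)^t* = P.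
  rewrite adjmx_mul mulmxA -[_ *m M *m _]mulmxA -/A aJ -{1}(fcalc_id aA) /J !fcalcM.
  apply: eq_fcalc => i; rewrite /invsqrt; set x := spectral_diag A 0 i.
  have [->|nz] := eqVneq x 0; first by rewrite sqrtC0 mulr0 !mul0r.
  have nz' : sqrtC x != 0 by rewrite sqrtC_eq0.
  by rewrite -{2}[x]sqrtCK expr2 mulKf // divff.
rewrite mulmxA /P /J fcalcM; set F := fcalc _ A.
suff -> : F = fcalc invsqrt A *m P by rewrite -mulmxA PM.
by rewrite /P fcalcM; apply: eq_fcalc => i; rewrite mulrC.
Qed.

(* Together with [tnorm_sqrt_attained], Uhlmann's theorem. *)
Lemma tnorm_sqrt_ge m k (M N : 'M[C]_(m, k)) :
  `|\tr (M^t* *m N)| <= tnorm (fcalc sqrtC (M *m M^t*) *m fcalc sqrtC (N *m N^t*)).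
Proof.
have [Y eM hY] := gram_polar M; have [Z eN hZ] := gram_polar N.
set S := fcalc _ (M *m _) in eM *; set T := fcalc _ (N *m _) in eN *.
have aS : S^t* = S := fcalc_sqrt_adj (psd_gram M).
(* With [M = S Y] and [N = T Z], cyclicity leaves [S T] tested against the product of the
   contractions [Z] and [Y^*]. *)
have -> : \tr (M^t* *m N) = \tr ((Z *m Y^t*) *m (S *m T)).
  by rewrite eM eN adjmx_mul aS !mulmxA mxtrace_mulC !mulmxA.
apply: contraction_trace_le; apply: contraction_mul; apply: partial_isometry_contraction => //.
exact: partial_isometry_adj.
Qed.

(* The second block of [M] completes the partial isometry of the polar decomposition of
   [sqrt a *m sqrt b] to a coisometry. *)
Lemma tnorm_sqrt_attained n (a b : 'M[C]_n) : psd a -> psd b ->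
  exists2 M : 'M[C]_(n, n + n), M *m M^t* = a &
    \tr (M^t* *m row_mx (fcalc sqrtC b) 0) = tnorm (fcalc sqrtC a *m fcalc sqrtC b).
Proof.
move=> pa pb; set ra := fcalc sqrtC a; set rb := fcalc sqrtC b.
set A := ra *m rb; have eA : A = ra *m rb by []; clearbody A.
pose B := A^t* *m A; have pB : psd B := psd_adjmul A.
have ge0 i : 0 <= spectral_diag B 0 i := psd_spectral_ge0 i pB.
pose J := fcalc invsqrt B.
have aJ : J^t* = J.
  rewrite /J fcalc_adj; apply: eq_fcalc => i.
  by apply/CrealP; rewrite /invsqrt ger0_real // invr_ge0 sqrtC_ge0.
have eJ : J = fcalc invsqrt B by [].
have eB : A^t* *m A = B by [].
clearbody J B; pose V := A *m J.
have aV : V^t* = J *m A^t* by rewrite adjmx_mul aJ.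
have VV : V *m V^t* *m V = V.
  rewrite aV /V !mulmxA -[_ *m A^t* *m A]mulmxA eB -!mulmxA; congr (_ *m _).
  rewrite -{1}(fcalc_id (psd_adj pB)) eJ !mulmxA !fcalcM; apply: eq_fcalc => i.
  rewrite /invsqrt; set x := spectral_diag B 0 i.
  have [->|nz] := eqVneq x 0; first by rewrite sqrtC0 invr0 !mul0r.
  have nz' : sqrtC x != 0 by rewrite sqrtC_eq0.
  by rewrite -[X in _ * X * _]sqrtCK; field.
clearbody V; pose E := V *m V^t*.
have EE : E *m E = E by rewrite /E mulmxA VV.
have aE : E^t* = E by rewrite adjmx_mul trmxCK.
have eE : V *m V^t* = E by [].
clearbody E.
exists (row_mx (ra *m V) (ra *m (1%:M - E))).
  rewrite tr_row_mx map_col_mx mul_row_col !adjmx_mul adjmx_sub adjmx1 aE.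
  rewrite fcalc_sqrt_adj // !mulmxA -[_ *m V *m _]mulmxA eE -[_ *m (_ - _) *m (_ - _)]mulmxA.
  rewrite (idempotent_compl EE) -mulmxDl -mulmxDr.
  by rewrite addrC subrK mulmx1 fcalc_sqrtK.
(* The zero block removes the completion; what remains is the trace of [V^* A = J B], the square
   root of [B]. *)
rewrite tr_row_mx map_col_mx mul_col_row !mulmx0 mxtrace_block mxtrace0 addr0.
rewrite adjmx_mul fcalc_sqrt_adj // -mulmxA aV -mulmxA -eA eB tnormE eB.
rewrite -{1}(fcalc_id (psd_adj pB)) eJ fcalcM; congr (\tr _); apply: eq_fcalc => i.
rewrite /invsqrt; set x := spectral_diag B 0 i.
have [->|nz] := eqVneq x 0; first by rewrite sqrtC0 mulr0.
by rewrite -{2}[x]sqrtCK expr2 mulKf // sqrtC_eq0.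
Qed.

End Matrices.

(** * Triangle inequality and a second-moment lower bound for the fidelity *)

Section Uhlmann.
Variable C : numClosedFieldType.

Lemma mxtrace_adjmulC m n (M N : 'M[C]_(m, n)) :
  \tr (N^t* *m M) = (\tr (M^t* *m N))^*.
Proof.
rewrite !mxtrace_adjmulE !rmorph_sum; apply: eq_bigr => i _.
rewrite rmorph_sum; apply: eq_bigr => j _.
by rewrite rmorphM /= conjCK mulrC.
Qed.

Lemma adjmx_scale m n (c : C) (A : 'M[C]_(m, n)) : (c *: A)^t* = c^* *: A^t*.
Proof. by apply/matrixP => i j; rewrite !mxE rmorphM. Qed.

Lemma gram_row_sqrt n p (b : 'M[C]_n) (N := row_mx (fcalc sqrtC b) (0 : 'M[C]_(n, p))) :
  psd b -> N *m N^t* = b.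
Proof.
move=> pb; rewrite tr_row_mx map_col_mx mul_row_col fcalc_sqrt_adj // fcalc_sqrtK //.
by rewrite mul0mx addr0.
Qed.

(* The triangle inequality for unit vectors [M], [N], [L] of the Hilbert-Schmidt space,
   [N] being a common purification of [b]. *)
Lemma tnorm_triangle n (a b c : 'M[C]_n) (x y z : C) :
  psd a -> psd b -> psd c -> \tr a = 1 -> \tr b = 1 -> \tr c = 1 ->
  tnorm (fcalc sqrtC a *m fcalc sqrtC b) = x ->
  tnorm (fcalc sqrtC c *m fcalc sqrtC b) = y ->
  tnorm (fcalc sqrtC a *m fcalc sqrtC c) = z ->
  [/\ x ^+ 2 <= 1, y ^+ 2 <= 1 &
   x * y <= z \/ (x * y - z) ^+ 2 <= (1 - x ^+ 2) * (1 - y ^+ 2)].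
Proof.
move=> pa pb pc ta tb tc ex ey ez.
have x0 : 0 <= x by rewrite -ex tnorm_ge0.
have y0 : 0 <= y by rewrite -ey tnorm_ge0.
have z0 : 0 <= z by rewrite -ez tnorm_ge0.
have [M eM MN] := tnorm_sqrt_attained pa pb; have [L eL LN] := tnorm_sqrt_attained pc pb.
rewrite ex in MN; rewrite ey in LN.
have eN := gram_row_sqrt n pb; move: (row_mx _ _) eN MN LN => N eN MN LN.
have := tnorm_sqrt_ge M L; rewrite eM eL ez => zML {ex ey ez}.
have cx : x^* = x by apply/CrealP/ger0_real.
have cy : y^* = y by apply/CrealP/ger0_real.
(* When [t] is the overlap with the unit vector [N], [K - t N] is the component of [K] orthogonal to
   [N]. *)
have dist K t : \tr (K *m K^t*) = 1 -> t^* = t -> \tr (K^t* *m N) = t ->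
    \tr ((K - t *: N) *m (K - t *: N)^t*) = 1 - t ^+ 2.
  move=> K1 ct KN; have NK : \tr (N^t* *m K) = t by rewrite mxtrace_adjmulC KN ct.
  rewrite mxtrace_mulC adjmx_sub adjmx_scale ct mulmxBl !mulmxBr -!scalemxAl -!scalemxAr.
  rewrite !raddfB /= !linearZ /= KN NK [\tr (K^t* *m K)]mxtrace_mulC K1.
  by rewrite [\tr (N^t* *m N)]mxtrace_mulC eN tb; ring.
have dM := dist M x (etrans (congr1 _ eM) ta) cx MN.
have dL := dist L y (etrans (congr1 _ eL) tc) cy LN.
split.
- by rewrite -subr_ge0 -dM mxtrace_gram_ge0.
- by rewrite -subr_ge0 -dL mxtrace_gram_ge0.
have [le_xyz|lt_zxy] := real_leP (ger0_real (mulr_ge0 x0 y0)) (ger0_real z0); [by left|right].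
(* Cauchy-Schwarz for the components of [M] and [L] orthogonal to [N]; their inner product is the
   overlap of [M] and [L] minus [x y]. The case [z < x y] allows the moduli to be compared. *)
rewrite -dM -dL (le_trans _ (mxtrace_CauchySchwarz _ _)) //.
have -> : \tr ((M - x *: N)^t* *m (L - y *: N)) = \tr (M^t* *m L) - x * y.
  have NL : \tr (N^t* *m L) = y by rewrite mxtrace_adjmulC LN cy.
  rewrite adjmx_sub adjmx_scale cx mulmxBl !mulmxBr -!scalemxAl -!scalemxAr.
  rewrite !raddfB /= !linearZ /= MN NL.
  by rewrite [\tr (N^t* *m N)]mxtrace_mulC eN tb; ring.
rewrite ler_pXn2r ?nnegrE ?subr_ge0 ?(ltW lt_zxy) // distrC.
rewrite (le_trans _ (lerB_dist _ _)) // ger0_norm ?mulr_ge0 //.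
by rewrite lerD2l lerN2.
Qed.

(** An overlap attaining one side is, after conjugation, a lower bound for the other. *)
Lemma tnorm_sqrtC n (a b : 'M[C]_n) : psd a -> psd b ->
  tnorm (fcalc sqrtC a *m fcalc sqrtC b) = tnorm (fcalc sqrtC b *m fcalc sqrtC a).
Proof.
suff le (c d : 'M[C]_n) : psd c -> psd d ->
    tnorm (fcalc sqrtC c *m fcalc sqrtC d) <= tnorm (fcalc sqrtC d *m fcalc sqrtC c).
  by move=> pa pb; apply/eqP; rewrite eq_le !le.
move=> pc pd; have [M eM e] := tnorm_sqrt_attained pc pd.
have eN := gram_row_sqrt n pd; move: (row_mx _ _) e eN => N e eN.
rewrite -(ger0_norm (tnorm_ge0 (fcalc sqrtC c *m _))) -e -norm_conjC -mxtrace_adjmulC.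
by have := tnorm_sqrt_ge N M; rewrite eM eN.
Qed.

(** The parabola through 0 that is tangent to the square root at 1. With [s^2 = x], twice the
    difference is [s (s - 1)^2 (s + 2)]. *)
Lemma sqrtC_ge_quadratic (x : C) : 0 <= x -> (3 * x - x ^+ 2) / 2 <= sqrtC x.
Proof.
move=> x0; have s0 : 0 <= sqrtC x by rewrite sqrtC_ge0.
rewrite -{1 2}[x]sqrtCK; move: (sqrtC x) s0 => s s0 {x x0}.
rewrite ler_pdivrMr // -subr_ge0.
have -> : s * 2 - (3 * s ^+ 2 - (s ^+ 2) ^+ 2) = s * (s - 1) ^+ 2 * (s + 2) by ring.
apply: mulr_ge0; last by rewrite addr_ge0.
apply: mulr_ge0 => //; rewrite real_exprn_even_ge0 // rpredB ?real1 //.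
exact: ger0_real.
Qed.

Lemma mxtrace_diag_mul n (w : 'rV[C]_n) (A : 'M[C]_n) :
  \tr (diag_mx w *m A) = \sum_i w 0 i * A i i.
Proof. by apply: eq_bigr => i _; rewrite mul_diag_mx mxE. Qed.

(* [Q] is the exponential of the Petz-Renyi divergence of order 2. The bound is
   [sqrt x >= (3 x - x^2) / 2] applied to [w^(-1/2) tau w^(-1/2)] in the state [w]. *)
Lemma tnorm_sqrt_diag_ge n (tau : 'M[C]_n) (w : 'rV[C]_n)
    (Q := \sum_i \sum_j `|tau i j| ^+ 2 / w 0 i) :
  psd tau -> \tr tau = 1 -> (forall i, 0 <= w 0 i) ->
  (forall i j, w 0 i = 0 -> tau i j = 0) ->
  (3 - Q) / 2 <= tnorm (fcalc sqrtC tau *m fcalc sqrtC (diag_mx w)).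
Proof.
move=> ptau ttau w0 supp.
have tauC i j : tau j i = (tau i j)^*.
  by rewrite -[in LHS](psd_adj ptau) !mxE.
have supp' i j : w 0 j = 0 -> tau i j = 0.
  by move=> wj; rewrite -[tau i j]conjCK -tauC supp // conjC0.
pose D := diag_mx (map_mx sqrtC w).
pose J := diag_mx (map_mx (@invsqrt C) w).
have aD : D^t* = D.
  rewrite adjmx_diag; congr diag_mx; apply/rowP => i; rewrite !mxE.
  by apply/CrealP/ger0_real; rewrite sqrtC_ge0.
have aJ : J^t* = J.
  rewrite adjmx_diag; congr diag_mx; apply/rowP => i; rewrite !mxE.
  by apply/CrealP/ger0_real; rewrite invr_ge0 sqrtC_ge0.
pose X := J *m tau *m J^t*.
have pX : psd X by apply: psd_conj.
have XE i j : X i j = tau i j / (sqrtC (w 0 i) * sqrtC (w 0 j)).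
  by rewrite /X aJ /J mul_mx_diag mul_diag_mx !mxE /invsqrt invfM; ring.
clearbody X.
have DD : D *m D^t* = diag_mx w.
  rewrite aD mulmx_diag; congr diag_mx; apply/rowP => i; rewrite !mxE.
  by rewrite -expr2 sqrtCK.
(* [w^(1/2) X^(1/2)] and [D = w^(1/2)] are purifications of [tau] and [diag_mx w], with overlap the
   trace of [w X^(1/2)]. *)
pose M := D *m fcalc sqrtC X.
have MM : M *m M^t* = tau.
  rewrite adjmx_mul fcalc_sqrt_adj // mulmxA -[_ *m _ *m fcalc _ _]mulmxA fcalc_sqrtK //.
  rewrite aD; apply/matrixP => i j; rewrite /D mul_mx_diag mul_diag_mx !mxE XE.
  have [wi|wi] := eqVneq (w 0 i) 0; first by rewrite supp // !(mul0r, mulr0).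
  have [wj|wj] := eqVneq (w 0 j) 0; first by rewrite supp' // !(mul0r, mulr0).
  by field; rewrite !sqrtC_eq0 wi wj.
have := tnorm_sqrt_ge M D; rewrite MM DD => h.
apply: le_trans h.
have -> : \tr (M^t* *m D) = \tr (diag_mx w *m fcalc sqrtC X).
  by rewrite adjmx_mul fcalc_sqrt_adj // -mulmxA mxtrace_mulC aD -{2}aD DD.
have c0 i := psd_diag_ge0 i (psd_conj (spectralmx X) (psd_gram D)).
rewrite DD in c0; have d0 i := psd_spectral_ge0 i pX.
(* The first two moments of [X] under the weight [w] are 1 and [Q], so the parabola averages to
   [(3 - Q) / 2]. Entries divided by a zero weight vanish by [supp]. *)
have m1 : \tr (diag_mx w *m X) = 1.
  rewrite mxtrace_diag_mul -ttau; apply: eq_bigr => i _; rewrite XE.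
  have [wi|wi] := eqVneq (w 0 i) 0; first by rewrite supp // !(mul0r, mulr0).
  by rewrite -expr2 sqrtCK; field.
have m2 : \tr (diag_mx w *m (X *m X)) = Q.
  rewrite mxtrace_diag_mul /Q [RHS]exchange_big; apply: eq_bigr => i _ /=.
  rewrite mxE mulr_sumr; apply: eq_bigr => j _; rewrite !XE normCK [tau i j]tauC.
  have [wi|wi] := eqVneq (w 0 i) 0; first by rewrite supp' // !(mul0r, mulr0).
  have [wj|wj] := eqVneq (w 0 j) 0; first by rewrite supp // !(mul0r, mulr0).
  rewrite -[X in X * _ = _]sqrtCK -[X in _ = _ / X]sqrtCK.
  by field; rewrite !sqrtC_eq0 wi wj.
have aX := psd_adj pX.
rewrite ger0_norm; last first.
  rewrite mxtrace_mul_fcalc sumr_ge0 // => i _.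
  by rewrite mulr_ge0 // sqrtC_ge0.
rewrite -m2 -{1}(fcalc_id aX) -{2}(fcalc_id aX) fcalcM.
have -> : 3 = 3 * \tr (diag_mx w *m X) :> C by rewrite m1 mulr1.
rewrite -{1}(fcalc_id aX) !mxtrace_mul_fcalc mulr_sumr -sumrB mulr_suml.
apply: ler_sum => i _; apply: le_trans (ler_wpM2l (c0 i) (sqrtC_ge_quadratic (d0 i))).
by rewrite le_eqVlt; apply/orP; left; apply/eqP; rewrite /=; ring.
Qed.

End Uhlmann.

Lemma psd_diag_mx (C : numClosedFieldType) n (w : 'rV[C]_n) :
  (forall i, 0 <= w 0 i) -> psd (diag_mx w).
Proof.
move=> w0; have -> : diag_mx w = diag_mx (map_mx sqrtC w) *m (diag_mx (map_mx sqrtC w))^t*.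
  rewrite adjmx_diag mulmx_diag; congr diag_mx; apply/rowP => i; rewrite !mxE.
  by rewrite (CrealP (ger0_real _)) ?sqrtC_ge0 // -expr2 sqrtCK.
exact: psd_gram.
Qed.

Lemma mul_adj_eqdim (C : numClosedFieldType) m n (M : 'M[C]_(m, n)) :
  m = n -> M *m M^t* = 1%:M -> M^t* *m M = 1%:M.
Proof. by move=> e; subst m; exact: mulmx1C. Qed.

Lemma adjmxE (C : numClosedFieldType) m n (M : 'M[C]_(m, n)) i j : M^t* i j = (M j i)^*%R.
Proof. by rewrite !mxE. Qed.

(** * Collision divergence of a dominated state *)

Section Petz.
Variable C : numClosedFieldType.

Lemma psd_le_trace n (A B : 'M[C]_n) (y : 'rV[C]_n) : psd (B - A) ->
  \tr (y *m A *m y^t*) <= \tr (y *m B *m y^t*).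
Proof.
move=> [_ /(_ y)]; rewrite -mxtrace11 mulmxBr mulmxBl raddfB /=.
by rewrite subr_ge0.
Qed.

Section Dominated.
Variables (n : nat) (rho : 'M[C]_n) (w : 'rV[C]_n) (K : C).
Hypotheses (prho : psd rho) (w0 : forall i, 0 <= w 0 i).
Hypothesis dom : psd (K *: diag_mx w - rho).

(** Domination gives [rho i i <= 0], so row [i] of the square root of [rho] has norm 0. *)
Lemma dominated_support i j : w 0 i = 0 -> rho i j = 0.
Proof.
move=> wi; set G := fcalc sqrtC rho.
have eG : G *m G^t* = rho by rewrite fcalc_sqrt_adj // fcalc_sqrtK.
have : row i G = 0.
  apply: mxtrace_gram_eq0; rewrite -diag_mul_adj eG; apply/eqP; rewrite eq_le.
  rewrite (psd_diag_ge0 i prho) andbT; have := psd_diag_ge0 i dom.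
  by rewrite !mxE eqxx wi mul0rn mulr0 sub0r oppr_ge0.
move=> /rowP Gi; rewrite -eG mxE big1 // => k _.
by have := Gi k; rewrite !mxE => ->; rewrite mul0r.
Qed.

(** The order-2 divergence is at most the max-divergence. The sum is the trace of [rho H], where
    [H = rho^(1/2) w^-1 rho^(1/2)]. Domination yields [H^2 <= K H], so [t = x H x^*] satisfies
    [t^2 <= |x H|^2 |x|^2 <= K t |x|^2], that is [t <= K |x|^2]; here [x] runs over the rows of
    [rho^(1/2)]. *)
Lemma dominated_sum_le : 0 <= K ->
  \sum_i \sum_j `|rho i j| ^+ 2 / w 0 i <= K * \tr rho.
Proof.
move=> K0; set G := fcalc sqrtC rho.
have eG : G *m G^t* = rho by rewrite fcalc_sqrt_adj // fcalc_sqrtK.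
pose J := diag_mx (map_mx (@GRing.inv C) w).
pose T := diag_mx (map_mx (@invsqrt C) w).
have aJ : J^t* = J.
  rewrite adjmx_diag; congr diag_mx; apply/rowP => i; rewrite !mxE.
  by apply/CrealP/ger0_real; rewrite invr_ge0.
have aT : T^t* = T.
  rewrite adjmx_diag; congr diag_mx; apply/rowP => i; rewrite !mxE.
  by apply/CrealP/ger0_real; rewrite invr_ge0 sqrtC_ge0.
have TT : T *m T = J.
  rewrite mulmx_diag; congr diag_mx; apply/rowP => i; rewrite !mxE /invsqrt.
  by rewrite -invfM -expr2 sqrtCK.
have JSJ : J *m diag_mx w *m J = J.
  rewrite !mulmx_diag; congr diag_mx; apply/rowP => i; rewrite !mxE.
  have [->|nz] := eqVneq (w 0 i) 0; first by rewrite invr0 !mulr0.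
  by rewrite mulVf // mul1r.
have -> : \sum_i \sum_j `|rho i j| ^+ 2 / w 0 i = \tr (J *m (rho *m rho)).
  rewrite mxtrace_diag_mul; apply: eq_bigr => i _; rewrite !mxE mulr_sumr.
  apply: eq_bigr => j _; rewrite mulrC normCK; congr (_ * (_ * _)).
  by rewrite -[in RHS](psd_adj prho) !mxE.
clearbody G J T; pose H := G^t* *m J *m G.
have -> : \tr (J *m (rho *m rho)) = \sum_i \tr (row i G *m H *m (row i G)^t*).
  rewrite mulmxA mxtrace_mulC.
  have -> : rho *m (J *m rho) = (G *m H) *m G^t* by rewrite -eG /H !mulmxA.
  by apply: eq_bigr => i _; rewrite diag_mul_adj row_mul.
have -> : K * \tr rho = \sum_i K * \tr (row i G *m (row i G)^t*).
  by rewrite -eG mulr_sumr; apply: eq_bigr => i _; rewrite diag_mul_adj.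
apply: ler_sum => i _; move: (row i G) => x.
set t := \tr (x *m H *m x^t*).
have aH : H^t* = H by rewrite !adjmx_mul trmxCK aJ mulmxA.
have t0 : 0 <= t.
  have -> : t = \tr ((x *m G^t* *m T) *m (x *m G^t* *m T)^t*).
    by rewrite /t /H !adjmx_mul trmxCK aT -TT !mulmxA.
  exact: mxtrace_gram_ge0.
have h1 : \tr (x *m H *m (x *m H)^t*) <= K * t.
  have := psd_le_trace (x *m G^t* *m J) dom.
  rewrite -scalemxAr -scalemxAl linearZ /=.
  have -> : \tr (x *m G^t* *m J *m diag_mx w *m (x *m G^t* *m J)^t*) = t.
    rewrite [(_ *m J)^t*]adjmx_mul aJ.
    have -> : x *m G^t* *m J *m diag_mx w *m (J *m (x *m G^t*)^t*) =
       x *m G^t* *m (J *m diag_mx w *m J) *m (x *m G^t*)^t* by rewrite !mulmxA.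
    by rewrite JSJ /t /H adjmx_mul trmxCK !mulmxA.
  by apply: le_trans; rewrite -eG adjmx_mul aH /H !adjmx_mul aJ trmxCK !mulmxA.
have h2 : t ^+ 2 <= \tr (x *m H *m (x *m H)^t*) * \tr (x *m x^t*).
  have := mxtrace_CauchySchwarz x (x *m H).
  by rewrite mxtrace_mulC -/t ger0_norm // mulrC.
have [->|tn0] := eqVneq t 0; first by rewrite mulr_ge0 ?mxtrace_gram_ge0.
have tpos : 0 < t by rewrite lt_def tn0.
rewrite -(ler_pM2l tpos) -expr2 (le_trans h2) // mulrA [t * K]mulrC.
by rewrite ler_wpM2r ?mxtrace_gram_ge0.
Qed.

End Dominated.
End Petz.

(** * Convex split and Bell vectors *)

Lemma ffun_eq_prod (C : comNzRingType) (J : finType) (A : eqType) (y y' : {ffun J -> A}) :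
  (y == y')%:R = \prod_i (y i == y' i)%:R :> C.
Proof.
have [->|ne] := eqVneq y y'; first by rewrite big1 // => i _; rewrite eqxx.
have [i nei] : exists i, y i != y' i.
  by apply/existsP; rewrite -[X in is_true X]negbK negb_exists; apply: contra ne => /forallP h;
     apply/eqP/ffunP => i; apply/eqP; rewrite -[_ == _]negbK.
by rewrite (bigD1 i) //= (negbTE nei) mul0r.
Qed.

Section ConvexSplit.
Variable C : numClosedFieldType.

Lemma sum_ffun_prod2 (I A : finType) (F : I -> A -> A -> C) :
  \sum_(z : {ffun I -> A}) \sum_(z' : {ffun I -> A}) \prod_i F i (z i) (z' i) =
  \prod_i \sum_a \sum_b F i a b.
Proof.
rewrite bigA_distr_bigA; apply: eq_bigr => z _.
by rewrite (bigA_distr_bigA (fun i b => F i (z i) b)).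
Qed.

Lemma sum_eq_mulr (A : finType) (a : A) (F : A -> C) : \sum_b (a == b)%:R * F b = F a.
Proof.
rewrite (bigD1 a) //= eqxx mul1r big1 ?addr0 // => b ne.
by rewrite eq_sym (negbTE ne) mul0r.
Qed.

Lemma exchange_big2 (I1 I2 J1 J2 : finType) (G : I1 -> I2 -> J1 -> J2 -> C) :
  \sum_i1 \sum_i2 \sum_j1 \sum_j2 G i1 i2 j1 j2 =
  \sum_j1 \sum_j2 \sum_i1 \sum_i2 G i1 i2 j1 j2.
Proof.
under eq_bigr do rewrite exchange_big /=.
rewrite exchange_big /=; apply: eq_bigr => j1 _.
under eq_bigr do rewrite exchange_big /=.
by rewrite exchange_big.
Qed.

Variables (J A E : finType).
Variables (r : A -> E -> A -> E -> C) (s : A -> C) (p : E -> C).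
Hypotheses (s0 : forall a, 0 <= s a) (s1 : \sum_a s a = 1).
Hypotheses (p0 : forall e, 0 <= p e) (p1 : \sum_e p e = 1).
Hypothesis r_supp : forall a e b f, s a = 0 -> r a e b f = 0.
Hypothesis r_marginal : forall e f, \sum_a r a e a f = (e == f)%:R * p e.

(** There is one site more than there are terms: [None] is the place first occupied by [A], and it
    holds [s] in every term. *)
Definition split_factor (j : J) (i : option J) a b e f : C :=
  if i == Some j then r a e b f else s a * (a == b)%:R.

(* The state with the system [A] of [r] at site [j] and [s] at every other site. *)
Definition split_term (j : J) (z z' : {ffun option J -> A}) e f : C :=
  \prod_i split_factor j i (z i) (z' i) e f.

Let conj_s a : (s a)^* = s a.
Proof. by apply/CrealP/ger0_real. Qed.

Let conj_p e : (p e)^* = p e.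
Proof. by apply/CrealP/ger0_real. Qed.

Let conj_eq (T : eqType) (a b : T) : ((a == b)%:R : C)^* = (a == b)%:R.
Proof. by rewrite rmorph_nat. Qed.

Let s_divK a (c : C) : (s a = 0 -> c = 0) -> c * s a / s a = c.
Proof.
have [->|nz] := eqVneq (s a) 0; last by rewrite mulfK.
by move=> /(_ erefl) ->; rewrite !mul0r.
Qed.

Let marginal_factor e f : \sum_a \sum_b r a e b f * (s a * (a == b)%:R) / s a = (e == f)%:R * p e.
Proof.
rewrite -r_marginal; apply: eq_bigr => a _.
under eq_bigr => b _ do rewrite [s a * _]mulrC mulrCA -mulrA.
by rewrite sum_eq_mulr s_divK // => /r_supp.
Qed.

(** The sum factors over the sites. A site other than [j] and [j'] contributes [\sum_a s a = 1]. If
    [j] and [j'] differ, each of the two meets a copy of [s], which cancels the inverse weight and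
    leaves the marginal of [r]. *)
Lemma split_overlap (j j' : J) e f :
  \sum_z \sum_z' split_term j z z' e f * (split_term j' z z' e f)^* / \prod_i s (z i) =
  if j == j' then \sum_a \sum_b `|r a e b f| ^+ 2 / s a else (e == f)%:R * p e ^+ 2.
Proof.
pose F i a b := split_factor j i a b e f * (split_factor j' i a b e f)^* / s a.
transitivity (\prod_i \sum_a \sum_b F i a b).
  rewrite -sum_ffun_prod2; apply: eq_bigr => z _; apply: eq_bigr => z' _.
  by rewrite /split_term /F rmorph_prod !big_split /= prodfV.
have F1 i : i != Some j -> i != Some j' -> \sum_a \sum_b F i a b = 1.
  move=> /negbTE nj /negbTE nj'; rewrite -s1; apply: eq_bigr => a _.
  rewrite -[RHS](@s_divK a) // -[RHS](sum_eq_mulr a (fun=> s a * s a / s a)).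
  apply: eq_bigr => b _; rewrite /F /split_factor nj nj' rmorphM /= conj_s conj_eq.
  by case: (a == b); rewrite ?mulr1 ?mul1r // !(mulr0, mul0r).
have [ej|nej] := eqVneq j j'.
  rewrite (bigD1 (Some j)) //= [X in _ * X]big1 ?mulr1; last first.
    by move=> i ni; rewrite F1 // -ej.
  apply: eq_bigr => a _; apply: eq_bigr => b _.
  by rewrite /F /split_factor -ej eqxx normCK.
rewrite (bigD1 (Some j)) //= (bigD1 (Some j')) /=; last by rewrite (inj_eq Some_inj) eq_sym.
rewrite [X in _ * (_ * X)]big1 ?mulr1; last by move=> i /andP[ni ni']; rewrite F1.
have -> : \sum_a \sum_b F (Some j) a b = (e == f)%:R * p e.
  rewrite -marginal_factor; apply: eq_bigr => a _; apply: eq_bigr => b _.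
  by rewrite /F /split_factor eqxx (inj_eq Some_inj) (negbTE nej) rmorphM /= conj_s conj_eq.
have -> : \sum_a \sum_b F (Some j') a b = (e == f)%:R * p e.
  transitivity ((\sum_a \sum_b r a e b f * (s a * (a == b)%:R) / s a)^*); last first.
    by rewrite marginal_factor rmorphM /= conj_p conj_eq.
  rewrite rmorph_sum; apply: eq_bigr => a _; rewrite rmorph_sum; apply: eq_bigr => b _.
  rewrite /F /split_factor eqxx (inj_eq Some_inj) [j' == j]eq_sym (negbTE nej).
  by rewrite !rmorphM /= fmorphV /= conj_s conj_eq; ring.
by case: (e == f); rewrite ?mul0r // !mul1r expr2.
Qed.

Definition split_average z z' e f : C := #|J|%:R^-1 * \sum_j split_term j z z' e f.

(** Expand the square into [n^2] pairs: an unequal pair contributes [\sum_e p e = 1], an equal pair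
    at most [K]. *)
Lemma split_average_sum_le (K : C) : (0 < #|J|)%N -> 0 <= K ->
  \sum_a \sum_e \sum_b \sum_f `|r a e b f| ^+ 2 / (s a * p e) <= K ->
  \sum_e \sum_f \sum_z \sum_z' `|split_average z z' e f| ^+ 2 / (\prod_i s (z i) * p e)
    <= 1 + K / #|J|%:R.
Proof.
move=> J0 K0 hK; set n : C := #|J|%:R.
have n0 : 0 < n by rewrite ltr0n.
have nn0 : n != 0 by rewrite gt_eqF.
pose D e f := \sum_a \sum_b `|r a e b f| ^+ 2 / s a.
have -> : \sum_e \sum_f \sum_z \sum_z'
      `|split_average z z' e f| ^+ 2 / (\prod_i s (z i) * p e) =
    n ^- 2 * \sum_(j : J) \sum_(j' : J) \sum_e \sum_f
      (if j == j' then D e f else (e == f)%:R * p e ^+ 2) / p e.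
  rewrite [in RHS]exchange_big2 mulr_sumr; apply: eq_bigr => e _.
  rewrite mulr_sumr; apply: eq_bigr => f _.
  transitivity (n ^- 2 * \sum_j \sum_j' \sum_z \sum_z'
      split_term j z z' e f * (split_term j' z z' e f)^* / (\prod_i s (z i) * p e)).
    rewrite [in RHS]exchange_big2 mulr_sumr; apply: eq_bigr => z _.
    rewrite mulr_sumr; apply: eq_bigr => z' _.
    rewrite /split_average normrM exprMn [`|\sum__ _| ^+ 2]normCK rmorph_sum.
    have -> : `|n^-1| ^+ 2 = n ^- 2 by rewrite ger0_norm ?exprVn // invr_ge0 ltW.
    rewrite -mulrA; congr (_ * _); rewrite !mulr_suml; apply: eq_bigr => j _.
    by rewrite mulr_sumr mulr_suml.
  congr (_ * _); apply: eq_bigr => j _; apply: eq_bigr => j' _.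
  rewrite -split_overlap mulr_suml; apply: eq_bigr => z _.
  by rewrite mulr_suml; apply: eq_bigr => z' _; rewrite invfM mulrA.
have eD : \sum_e \sum_f D e f / p e = \sum_a \sum_e \sum_b \sum_f `|r a e b f| ^+ 2 / (s a * p e).
  rewrite [RHS]exchange_big; apply: eq_bigr => e _ /=.
  under [RHS]eq_bigr do rewrite exchange_big /=.
  rewrite [RHS]exchange_big; apply: eq_bigr => f _ /=.
  rewrite /D mulr_suml; apply: eq_bigr => a _; rewrite mulr_suml; apply: eq_bigr => b _.
  by rewrite invfM mulrA.
(* Equal pairs are given an extra 1, so that the bound sums to [n^2 + n K]. *)
have le1 j j' : \sum_e \sum_f (if j == j' then D e f else (e == f)%:R * p e ^+ 2) / p e
    <= (j == j')%:R * K + 1.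
  case: eqP => _; first by rewrite eD mul1r (le_trans hK) // lerDl.
  rewrite mul0r add0r -[leRHS]p1; apply: ler_sum => e _.
  under eq_bigr do rewrite -mulrA.
  rewrite sum_eq_mulr.
  have [->|nz] := eqVneq (p e) 0; first by rewrite expr0n mul0r.
  by rewrite expr2 mulfK.
have -> : 1 + K / n = n ^- 2 * \sum_(j : J) \sum_(j' : J) ((j == j')%:R * K + 1).
  under eq_bigr => j _ do rewrite big_split /= (sum_eq_mulr j (fun=> K)) sumr_const.
  by rewrite sumr_const -mulr_natl -/n; field.
apply: ler_wpM2l; first by rewrite invr_ge0 exprn_ge0 ?ltW.
by do 2!(apply: ler_sum => ? _); exact: le1.
Qed.

End ConvexSplit.

(** * A basis of maximally entangled vectors on two registers of [m] bits *)

Section Bell.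
Variables (C : numClosedFieldType) (m : nat).
Let X : finType := {ffun 'I_m -> bool}.

(** The characters of the group of bit strings of length [m] under [ffun_xor]. *)
Definition walsh (p k : X) : C := \prod_i (-1) ^+ (p i && k i).

Definition ffun_xor (k q : X) : X := [ffun i => k i (+) q i].

(** The image of a maximally entangled vector under a Pauli operator on one half, with phase flips
    [j.1] and bit flips [j.2]. *)
Definition bell_vector (j : X * X) (k l : X) : C :=
  sqrtC #|X|%:R^-1 * walsh j.1 k * (l == ffun_xor k j.2)%:R.

Let X_neq0 : #|X|%:R != 0 :> C.
Proof. by rewrite pnatr_eq0 -lt0n; apply/card_gt0P; exists [ffun=> true]. Qed.

Let walsh_conj p k : (walsh p k)^* = walsh p k.
Proof. by rewrite rmorph_prod; apply: eq_bigr => i _; rewrite rmorph_sign. Qed.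

Let sqrt_conj : sqrtC #|X|%:R^-1 * (sqrtC #|X|%:R^-1)^* = #|X|%:R^-1 :> C.
Proof.
rewrite (CrealP (ger0_real _)) ?sqrtC_ge0 ?invr_ge0 ?ler0n //.
by rewrite -expr2 sqrtCK.
Qed.

Lemma walsh_sqr p k : walsh p k * walsh p k = 1.
Proof. by rewrite -big_split /= big1 // => i _; rewrite -expr2 sqrr_sign. Qed.

Lemma walsh_orthogonal k k' : \sum_p walsh p k * walsh p k' = #|X|%:R * (k == k')%:R.
Proof.
under eq_bigr do rewrite -big_split /=.
rewrite -(bigA_distr_bigA (fun i (b : bool) => (-1) ^+ (b && k i) * (-1) ^+ (b && k' i))).
rewrite ffun_eq_prod (eq_bigr (fun i => 2 * (k i == k' i)%:R)).
  by rewrite big_split /= prodr_const card_ffun card_bool card_ord natrX.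
move=> i _; rewrite big_bool /=.
by case: (k i); case: (k' i); rewrite /= ?expr0 ?expr1; ring.
Qed.

Let bell_mul_conj j k l k' l' : bell_vector j k l * (bell_vector j k' l')^* =
  #|X|%:R^-1 * (walsh j.1 k * walsh j.1 k') *
  ((l == ffun_xor k j.2) && (l' == ffun_xor k' j.2))%:R.
Proof.
rewrite /bell_vector !rmorphM /= walsh_conj rmorph_nat -mulnb natrM -[in RHS]sqrt_conj.
by ring.
Qed.

(** [k] and [l] determine each other once [j] is fixed, so distinct [k] never meet and the signs
    square to 1. *)
Lemma bell_entangled j k k' :
  \sum_l bell_vector j k l * (bell_vector j k' l)^* = (k == k')%:R / #|X|%:R.
Proof.
under eq_bigr do rewrite bell_mul_conj.
rewrite (bigD1 (ffun_xor k j.2)) //= big1 ?addr0; last first.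
  by move=> l /negbTE ->; rewrite mulr0.
have -> : (ffun_xor k j.2 == ffun_xor k' j.2) = (k == k').
  apply/eqP/eqP => [/ffunP h|->//]; apply/ffunP => i.
  by have := h i; rewrite !ffunE => /addIb.
rewrite eqxx; case: eqP => [->|_]; last by rewrite mulr0 mul0r.
by rewrite walsh_sqr !mulr1 mul1r.
Qed.

(** Orthogonality of characters in [p] forces [k = k']; then exactly one shift [q] takes [k] to
    [l]. *)
Lemma bell_basis k l k' l' :
  \sum_j bell_vector j k l * (bell_vector j k' l')^* = ((k == k') && (l == l'))%:R.
Proof.
under eq_bigr do rewrite bell_mul_conj.
rewrite -(pair_bigA _ (fun p q => #|X|%:R^-1 * (walsh p k * walsh p k') *
  ((l == ffun_xor k q) && (l' == ffun_xor k' q))%:R)) /=.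
under eq_bigr do rewrite -mulr_sumr.
rewrite -mulr_suml -mulr_sumr walsh_orthogonal mulKf //.
case: eqP => [->|_]; last by rewrite mul0r.
rewrite mul1r (bigD1 (ffun_xor k' l)) //= big1 ?addr0; last first.
  move=> q ne; case: eqP => // e; case/eqP: ne; apply/ffunP => i.
  by rewrite e !ffunE addKb.
have -> : ffun_xor k' (ffun_xor k' l) = l by apply/ffunP => i; rewrite !ffunE addKb.
by rewrite eqxx [l' == l]eq_sym.
Qed.

End Bell.

Import numFieldNormedType.Exports.

Local Open Scope classical_set_scope.
Local Open Scope ring_scope.
Local Open Scope complex_scope.
Local Open Scope sesquilinear_scope.

(** * Tensor products, channels and purified distance *)

Section Tensor.
Variable C : numClosedFieldType.

Lemma big_mxtens m n (F : 'I_(m * n) -> C) :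
  \sum_i F i = \sum_a \sum_b F (mxtens_index (a, b)).
Proof.
rewrite pair_big (reindex (fun p : 'I_m * 'I_n => mxtens_index p)) /=.
  by apply: eq_bigr => -[].
exists (@mxtens_unindex m n) => x _; [exact: mxtens_indexK|exact: mxtens_unindexK].
Qed.

Lemma eq_mxtens_index m n (a a' : 'I_m) (b b' : 'I_n) :
  (mxtens_index (a, b) == mxtens_index (a', b')) = (a == a') && (b == b').
Proof. by rewrite (can_eq (@mxtens_indexK m n)) xpair_eqE. Qed.

Lemma mxtens_matrixP m n p q (A B : 'M[C]_(m * n, p * q)) :
  (forall a b c d, A (mxtens_index (a, b)) (mxtens_index (c, d)) =
                   B (mxtens_index (a, b)) (mxtens_index (c, d))) -> A = B.
Proof.
move=> h; apply/matrixP => i j.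
by case: (mxtens_indexP i) => a b; case: (mxtens_indexP j) => c d.
Qed.

Lemma adjmx_tens m n p q (A : 'M[C]_(m, n)) (B : 'M[C]_(p, q)) :
  (A *t B)^t* = A^t* *t B^t*.
Proof. by rewrite trmx_tens map_mxT. Qed.

Lemma mxtrace_tens m n (A : 'M[C]_m) (B : 'M[C]_n) : \tr (A *t B) = \tr A * \tr B.
Proof.
rewrite /mxtrace big_mxtens mulr_suml; apply: eq_bigr => a _.
by rewrite mulr_sumr; apply: eq_bigr => b _; rewrite tensmxE.
Qed.

End Tensor.

(** * Ancillas and partial traces acting on Gram factors *)

Section Channels.
Variable R : realType.
Local Notation C := R[i].

Lemma add_ancillaE dA dE dA' (rho : 'M[C]_(dA * dE)) (sigma : 'M[C]_dA') a a' e b b' f :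
  add_ancilla rho sigma (mxtens_index (mxtens_index (a, a'), e))
                        (mxtens_index (mxtens_index (b, b'), f)) =
  rho (mxtens_index (a, e)) (mxtens_index (b, f)) * sigma a' b'.
Proof. by rewrite mxE !mxtens_indexK. Qed.

Lemma ptrace_midE m p n (A : 'M[C]_((m * p) * n)) a e b f :
  ptrace_mid A (mxtens_index (a, e)) (mxtens_index (b, f)) =
  \sum_k A (mxtens_index (mxtens_index (a, k), e))
           (mxtens_index (mxtens_index (b, k), f)).
Proof. by rewrite mxE !mxtens_indexK. Qed.

(** Adjoining the ancilla at the level of purifications: the columns index the purifying systems. *)
Definition lift_ancilla dA dE dA' k l (B : 'M[C]_(dA', l)) (M : 'M[C]_(dA * dE, k)) :
    'M[C]_((dA * dA') * dE, k * l) :=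
  \matrix_(i, j)
    let: (aa', e) := mxtens_unindex i in
    let: (a, a') := mxtens_unindex aa' in
    let: (c, c') := mxtens_unindex j in M (mxtens_index (a, e)) c * B a' c'.

Lemma lift_ancilla_gram dA dE dA' k l (B : 'M[C]_(dA', l)) (M N : 'M[C]_(dA * dE, k)) :
  lift_ancilla B M *m (lift_ancilla B N)^t* = add_ancilla (M *m N^t*) (B *m B^t*).
Proof.
apply: mxtens_matrixP => aa' e bb' f.
case: (mxtens_indexP aa') => a a'; case: (mxtens_indexP bb') => b b'.
rewrite add_ancillaE [LHS]mxE big_mxtens [(M *m _) _ _]mxE [(B *m _) _ _]mxE mulr_suml.
apply: eq_bigr => c _; rewrite mulr_sumr; apply: eq_bigr => c' _.
by rewrite !mxE !mxtens_indexK rmorphM /=; ring.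
Qed.

(** At the level of purifications a partial trace is only a regrouping: the discarded index joins
    the columns. *)
Definition lift_ptrace_mid m p n k (M : 'M[C]_((m * p) * n, k)) : 'M[C]_(m * n, p * k) :=
  \matrix_(i, j)
    let: (a, e) := mxtens_unindex i in
    let: (b, c) := mxtens_unindex j in M (mxtens_index (mxtens_index (a, b), e)) c.

Lemma lift_ptrace_mid_gram m p n k (M N : 'M[C]_((m * p) * n, k)) :
  lift_ptrace_mid M *m (lift_ptrace_mid N)^t* = ptrace_mid (M *m N^t*).
Proof.
apply: mxtens_matrixP => a e b f; rewrite ptrace_midE [LHS]mxE big_mxtens.
apply: eq_bigr => j _; rewrite mxE; apply: eq_bigr => c _.
by rewrite !mxE !mxtens_indexK.
Qed.

Lemma mxtrace_ptrace_mid m p n (A : 'M[C]_((m * p) * n)) : \tr (ptrace_mid A) = \tr A.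
Proof.
rewrite /mxtrace !big_mxtens; apply: eq_bigr => a _; rewrite exchange_big.
by apply: eq_bigr => e _; rewrite ptrace_midE.
Qed.

Lemma mxtrace_add_ancilla dA dE dA' (rho : 'M[C]_(dA * dE)) (sigma : 'M[C]_dA') :
  \tr (add_ancilla rho sigma) = \tr rho * \tr sigma.
Proof.
rewrite /mxtrace !big_mxtens mulr_suml; apply: eq_bigr => a _.
rewrite mulr_suml exchange_big; apply: eq_bigr => e _ /=.
by rewrite mulr_sumr; apply: eq_bigr => a' _; rewrite add_ancillaE.
Qed.

Definition lift_ptrace1 m n k (M : 'M[C]_(m * n, k)) : 'M[C]_(n, m * k) :=
  \matrix_(i, j) let: (a, c) := mxtens_unindex j in M (mxtens_index (a, i)) c.

Lemma lift_ptrace1_gram m n k (M : 'M[C]_(m * n, k)) :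
  lift_ptrace1 M *m (lift_ptrace1 M)^t* = ptrace1 (M *m M^t*).
Proof.
apply/matrixP => e f; rewrite mxE big_mxtens mxE.
apply: eq_bigr => a _; rewrite mxE; apply: eq_bigr => c _.
by rewrite !mxE !mxtens_indexK.
Qed.

Lemma mxtrace_ptrace1 m n (A : 'M[C]_(m * n)) : \tr (ptrace1 A) = \tr A.
Proof.
rewrite /mxtrace big_mxtens exchange_big; apply: eq_bigr => e _.
by rewrite mxE.
Qed.

Lemma psd_gramP n (A : 'M[C]_n) : psdmx A -> exists M : 'M[C]_n, A = M *m M^t*.
Proof.
move=> pA; exists (fcalc sqrtC A).
by rewrite fcalc_sqrt_adj // fcalc_sqrtK.
Qed.

Lemma psd_ptrace1 m n (A : 'M[C]_(m * n)) : psdmx A -> psdmx (ptrace1 A).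
Proof. by case/psd_gramP => M ->; rewrite -lift_ptrace1_gram; exact: psd_gram. Qed.

Lemma state_ptrace1 m n (A : 'M[C]_(m * n)) : state A -> state (ptrace1 A).
Proof. by case=> pA tA; split; [exact: psd_ptrace1|rewrite mxtrace_ptrace1]. Qed.

End Channels.

(** * The purified distance through overlaps of purifications *)

Section PurifiedDistance.
Variable R : realType.
Local Notation C := R[i].

Lemma sqrtmxE n (A : 'M[C]_n) : sqrtmx A = fcalc sqrtC A.
Proof. by rewrite fcalcE /sqrtmx invmx_unitary ?spectral_unitarymx. Qed.

Lemma ge0_ReK (z : C) : 0 <= z -> (complex.Re z)%:C = z.
Proof. by case: z => a b; rewrite lecE /= => /andP[/eqP -> _]. Qed.

(** One normalized argument makes the correction term for subnormalized states vanish. *)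
Lemma fidelityE n (a b : 'M[C]_n) : \tr a = 1 ->
  (fidelity a b)%:C = tnorm (fcalc sqrtC a *m fcalc sqrtC b).
Proof.
move=> ta; rewrite /fidelity ta subrr mul0r sqrtr0 addr0 /trnorm !sqrtmxE -tnormE.
by rewrite ge0_ReK // tnorm_ge0.
Qed.

Lemma fidelity_ge0 n (a b : 'M[C]_n) : \tr a = 1 -> 0 <= fidelity a b.
Proof. by move=> ta; rewrite -ler0c fidelityE ?tnorm_ge0. Qed.

Lemma fidelity_ge n k (M N : 'M[C]_(n, k)) : \tr (M *m M^t*) = 1 ->
  `|\tr (M^t* *m N)| <= (fidelity (M *m M^t*) (N *m N^t*))%:C.
Proof. by move=> t1; rewrite fidelityE // tnorm_sqrt_ge. Qed.

Lemma fidelity_attained n (a b : 'M[C]_n) : psdmx a -> psdmx b -> \tr a = 1 ->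
  exists M N : 'M[C]_(n, n + n),
    [/\ M *m M^t* = a, N *m N^t* = b & \tr (M^t* *m N) = (fidelity a b)%:C].
Proof.
move=> pa pb ta; have [M eM eMN] := tnorm_sqrt_attained pa pb.
exists M, (row_mx (fcalc sqrtC b) 0); split=> //; first exact: gram_row_sqrt.
by rewrite fidelityE.
Qed.

Lemma le_purified_dist n m (a b : 'M[C]_n) (c d : 'M[C]_m) :
  0 <= fidelity a b -> fidelity a b <= fidelity c d ->
  purified_dist c d <= purified_dist a b.
Proof.
move=> F0 le; rewrite ler_wsqrtr // lerD2l lerN2 ler_pXn2r ?nnegrE //.
exact: le_trans le.
Qed.

Lemma purified_dist_sym n (a b : 'M[C]_n) : state a -> state b ->
  purified_dist a b = purified_dist b a.
Proof.
move=> [pa ta] [pb tb]; rewrite /purified_dist; congr (Num.sqrt (1 - _ ^+ 2)).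
apply: complexI; rewrite (fidelityE b ta) (fidelityE a tb).
exact: (tnorm_sqrtC pa pb).
Qed.

(** For [x] and [y] the cosines of two angles, the disjunction says that [z] is at least the cosine
    of their sum; the sine of a sum is at most the sum of the sines. *)
Lemma sqrt_arc_triangle (x y z : R) : 0 <= x -> 0 <= y -> 0 <= z ->
  x ^+ 2 <= 1 -> y ^+ 2 <= 1 ->
  x * y <= z \/ (x * y - z) ^+ 2 <= (1 - x ^+ 2) * (1 - y ^+ 2) ->
  Num.sqrt (1 - z ^+ 2) <= Num.sqrt (1 - x ^+ 2) + Num.sqrt (1 - y ^+ 2).
Proof.
move=> x0 y0 z0 x1 y1 h.
set X := Num.sqrt (1 - x ^+ 2); set Y := Num.sqrt (1 - y ^+ 2).
have X0 : 0 <= X := sqrtr_ge0 _; have Y0 : 0 <= Y := sqrtr_ge0 _.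
have eX : X ^+ 2 = 1 - x ^+ 2 by rewrite sqr_sqrtr ?subr_ge0.
have eY : Y ^+ 2 = 1 - y ^+ 2 by rewrite sqr_sqrtr ?subr_ge0.
have XY0 : 0 <= X * Y by exact: mulr_ge0.
have xy0 : 0 <= x * y by exact: mulr_ge0.
have key : x * y - z <= X * Y.
  case: h => [h|h]; first lra.
  rewrite (le_trans (ler_norm _)) // -(@ler_pXn2r _ 2) ?nnegrE // exprMn eX eY.
  by rewrite real_normK // num_real.
suff : 1 - z ^+ 2 <= (X + Y) ^+ 2.
  move=> le; rewrite -[leRHS]ger0_norm ?addr_ge0 // -sqrtr_sqr.
  exact: ler_wsqrtr.
(* If the angles add up to more than a right angle, the second case, then [X^2 + Y^2 >= 1] already
   suffices. *)
have [le_XY|lt_xy] := lerP (X * Y) (x * y).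
  have zz : (x * y - X * Y) ^+ 2 <= z ^+ 2 by rewrite ler_pXn2r ?nnegrE //; lra.
  have id : 1 - (x * y - X * Y) ^+ 2 = (x * Y + y * X) ^+ 2.
    have -> : 1 = (x ^+ 2 + X ^+ 2) * (y ^+ 2 + Y ^+ 2) :> R by rewrite eX eY; ring.
    by ring.
  have lx : x <= 1 by rewrite -(@ler_pXn2r _ 2) ?nnegrE // expr1n.
  have ly : y <= 1 by rewrite -(@ler_pXn2r _ 2) ?nnegrE // expr1n.
  have : (x * Y + y * X) ^+ 2 <= (X + Y) ^+ 2.
    rewrite ler_pXn2r ?nnegrE ?addr_ge0 ?mulr_ge0 // [X + Y]addrC.
    by rewrite lerD // ler_piMl.
  lra.
have : (x * y) ^+ 2 <= (X * Y) ^+ 2 by rewrite ler_pXn2r ?nnegrE // ltW.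
rewrite sqrrD !exprMn eX eY; have := sqr_ge0 z; nra.
Qed.

Lemma purified_dist_triangle n (a b c : 'M[C]_n) : state a -> state b -> state c ->
  purified_dist a c <= purified_dist a b + purified_dist b c.
Proof.
move=> sa sb sc; rewrite (purified_dist_sym sb sc).
case: sa sb sc => [pa ta] [pb tb] [pc tc].
have [xx yy h] := tnorm_triangle pa pb pc ta tb tc
  (esym (fidelityE b ta)) (esym (fidelityE b tc)) (esym (fidelityE c ta)).
have := fidelity_ge0 b ta; have := fidelity_ge0 b tc; have := fidelity_ge0 c ta.
rewrite /purified_dist.
move: (fidelity a b) (fidelity a c) (fidelity c b) xx yy h => x z y xx yy h z0 y0 x0.
apply: sqrt_arc_triangle => //; try by rewrite -lecR rmorphXn.
case: h => h; [left|right]; first by rewrite -lecR rmorphM.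
by rewrite -lecR rmorphXn rmorphM !rmorphB rmorphM !rmorphXn.
Qed.

Lemma purified_dist_isometry m n (V : 'M[C]_(m, n)) (a b : 'M[C]_n) :
  V^t* *m V = 1%:M -> state a -> state b ->
  purified_dist (V *m a *m V^t*) (V *m b *m V^t*) <= purified_dist a b.
Proof.
move=> VV [pa ta] [pb tb]; have [M [N [eM eN eMN]]] := fidelity_attained pa pb ta.
apply: le_purified_dist; first exact: fidelity_ge0.
rewrite -lecR -eMN -eM -eN.
have e p (K : 'M[C]_(n, p)) : V *m (K *m K^t*) *m V^t* = (V *m K) *m (V *m K)^t*.
  by rewrite adjmx_mul !mulmxA.
rewrite !e; apply: le_trans (fidelity_ge _ _); last first.
  by rewrite -e eM mxtrace_mulC mulmxA VV mul1mx.
rewrite adjmx_mul -mulmxA [_ *m (V *m N)]mulmxA VV mul1mx.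
by rewrite eMN ger0_norm // ler0c fidelity_ge0.
Qed.

Lemma state_isometry m n (V : 'M[C]_(m, n)) (a : 'M[C]_n) :
  V^t* *m V = 1%:M -> state a -> state (V *m a *m V^t*).
Proof.
move=> VV [pa ta]; split; first exact: psd_conj.
by rewrite mxtrace_mulC mulmxA VV mul1mx.
Qed.

(* Rescaling a subnormalized state to trace one only moves it closer to [a]. *)
Lemma purified_dist_normalize n (a b : 'M[C]_n) (t : R) : state a -> psdmx b ->
  0 < t -> t <= 1 ->
  purified_dist a ((t^-1)%:C *: b) <= purified_dist a b.
Proof.
move=> [pa ta] pb t0 t1; have [M [N [eM eN eMN]]] := fidelity_attained pa pb ta.
apply: le_purified_dist; first exact: fidelity_ge0.
(* Scaling the optimal purification of [b] by [t^(-1/2) >= 1] purifies the rescaled state and can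
   only enlarge the overlap. *)
rewrite -lecR -eMN; pose s := (Num.sqrt t)^-1; pose N' := s%:C *: N.
have s0 : 0 <= s by rewrite invr_ge0 sqrtr_ge0.
have eN' : N' *m N'^t* = (t^-1)%:C *: b.
  rewrite adjmx_scale -scalemxAl -scalemxAr scalerA eN; congr (_ *: _).
  have -> : Num.conj (s%:C) = s%:C by apply/CrealP/ger0_real; rewrite ler0c.
  by rewrite -rmorphM -invfM -expr2 sqr_sqrtr // ltW.
have := fidelity_ge N' (etrans (congr1 _ eM) ta); rewrite eM eN'; apply: le_trans.
rewrite -scalemxAr linearZ /= normrM eMN (ger0_norm (_ : 0 <= (fidelity a b)%:C)) ?ler0c ?fidelity_ge0 //.
rewrite ler_peMl ?ler0c ?fidelity_ge0 // ger0_norm ?ler0c //.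
rewrite -[1]/((1 : R)%:C) lecR invf_ge1 ?sqrtr_gt0 //.
by rewrite -sqrtr1 ler_wsqrtr.
Qed.

(** Keeps the zero matrix out of balls of radius below 1, so that their members can be
    normalized. *)
Lemma purified_dist0 n (a : 'M[C]_n) : state a -> purified_dist a 0 = 1.
Proof.
move=> [pa ta]; have p0 : psdmx (0 : 'M[C]_n).
  by have := psd_gram (0 : 'M[C]_n); rewrite mul0mx.
have [M [N [eM /gram_eq0 -> ]]] := fidelity_attained pa p0 ta.
rewrite mulmx0 mxtrace0 => /complexI e.
by rewrite /purified_dist -e expr0n subr0 sqrtr1.
Qed.

Lemma purified_dist_le1 n (a b : 'M[C]_n) : purified_dist a b <= 1.
Proof. by rewrite -[leRHS]sqrtr1 ler_wsqrtr // gerBl sqr_ge0. Qed.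

(** The second-moment bound reads [F >= 1 - q^2 / 2], and [1 - F^2 <= 2 (1 - F)]. *)
Lemma purified_dist_diag_le n (tau : 'M[C]_n) (w : 'rV[C]_n) (q : R) :
  state tau -> (forall i, 0 <= w 0 i) -> \sum_i w 0 i = 1 ->
  (forall i j, w 0 i = 0 -> tau i j = 0) ->
  \sum_i \sum_j `|tau i j| ^+ 2 / w 0 i <= (1 + q ^+ 2)%:C -> 0 <= q ->
  purified_dist tau (diag_mx w) <= q.
Proof.
move=> [ptau ttau] w0 sw supp hQ q0.
have := tnorm_sqrt_diag_ge ptau ttau w0 supp.
rewrite -fidelityE //; set F := fidelity _ _ => hF.
have {hF hQ} h : (3 - (1 + q ^+ 2)) / 2 <= F.
  rewrite -lecR (le_trans _ hF) // rmorphM /= fmorphV rmorphB !rmorph_nat.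
  by rewrite ler_wpM2r ?invr_ge0 // lerD2l lerN2.
rewrite /purified_dist -[leRHS](ger0_norm q0) -sqrtr_sqr ler_wsqrtr // -/F.
have := sqr_ge0 (1 - F); rewrite sqrrB expr1n; lra.
Qed.

End PurifiedDistance.

(** * Monotonicity under the channel and invariance under local unitaries *)

Section Decoupling.
Variable R : realType.
Local Notation C := R[i].

Lemma sum_scalar1 n (a : 'I_n) (F : 'I_n -> C) :
  \sum_b (1%:M : 'M[C]_n) a b * F b = F a.
Proof.
rewrite (bigD1 a) //= mxE eqxx mul1r big1 ?addr0 // => b ne.
by rewrite mxE eq_sym (negbTE ne) mul0r.
Qed.

Lemma lift_ancilla_mul dA dE dA' k l (u : 'M[C]_dA) (v : 'M[C]_dE)
    (B : 'M[C]_(dA', l)) (M : 'M[C]_(dA * dE, k)) :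
  lift_ancilla B ((u *t v) *m M) = ((u *t 1%:M) *t v) *m lift_ancilla B M.
Proof.
apply: mxtens_matrixP => aa' e c c'; case: (mxtens_indexP aa') => a a'.
rewrite [LHS]mxE !mxtens_indexK [((_ *t v) *m M) _ _]mxE big_mxtens mulr_suml.
rewrite [RHS]mxE big_mxtens big_mxtens; apply: eq_bigr => b _.
rewrite mulr_suml exchange_big; apply: eq_bigr => f _ /=.
under [RHS]eq_bigr => b' _ do rewrite !tensmxE [lift_ancilla _ _ _ _]mxE !mxtens_indexK
  -!mulrA mulrCA.
by rewrite sum_scalar1 tensmxE; ring.
Qed.

Lemma add_ancilla_conj dA dE dA' (u : 'M[C]_dA) (v : 'M[C]_dE) (rho : 'M[C]_(dA * dE))
    (sigma : 'M[C]_dA') (g := u *t v) (G := (u *t 1%:M) *t v) :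
  psdmx rho -> psdmx sigma ->
  add_ancilla (g *m rho *m g^t*) sigma = G *m add_ancilla rho sigma *m G^t*.
Proof.
move=> /psd_gramP[M ->] /psd_gramP[B ->].
have -> : g *m (M *m M^t*) *m g^t* = (g *m M) *m (g *m M)^t*.
  by rewrite adjmx_mul !mulmxA.
by rewrite -!lift_ancilla_gram lift_ancilla_mul adjmx_mul !mulmxA.
Qed.

Lemma lift_ptrace_mid_mul m p n k (v : 'M[C]_n) (M : 'M[C]_((m * p) * n, k)) :
  lift_ptrace_mid ((1%:M *t v) *m M) = (1%:M *t v) *m lift_ptrace_mid M.
Proof.
apply: mxtens_matrixP => a e j c.
rewrite [LHS]mxE !mxtens_indexK [LHS]mxE [LHS]big_mxtens [RHS]mxE [RHS]big_mxtens.
rewrite exchange_big [RHS]exchange_big; apply: eq_bigr => f _ /=.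
rewrite (eq_bigr (fun bb => (1%:M : 'M[C]_(m * p)) (mxtens_index (a, j)) bb *
   (v e f * M (mxtens_index (bb, f)) c))); last first.
  by move=> bb _; rewrite tensmxE mulrA.
rewrite sum_scalar1.
rewrite (eq_bigr (fun b => (1%:M : 'M[C]_m) a b *
   (v e f * M (mxtens_index (mxtens_index (b, j), f)) c))); last first.
  by move=> bb _; rewrite tensmxE mulrA [lift_ptrace_mid _ _ _]mxE !mxtens_indexK.
by rewrite sum_scalar1.
Qed.

Lemma ptrace_mid_conj m p n (v : 'M[C]_n) (A : 'M[C]_((m * p) * n)) : psdmx A ->
  ptrace_mid ((1%:M *t v) *m A *m (1%:M *t v)^t*) =
  (1%:M *t v) *m ptrace_mid A *m (1%:M *t v)^t*.
Proof.
move=> /psd_gramP[M ->]; set g := _ *t v; set h := _ *t v.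
have -> : g *m (M *m M^t*) *m g^t* = (g *m M) *m (g *m M)^t*.
  by rewrite adjmx_mul !mulmxA.
by rewrite -!lift_ptrace_mid_gram lift_ptrace_mid_mul adjmx_mul !mulmxA.
Qed.

(** The traced-out index has become a column index, so [u] acts from the right, transposed; a
    unitary [u] then cancels in the Gram matrix. *)
Lemma lift_ptrace1_mul m n k (u : 'M[C]_m) (v : 'M[C]_n) (M : 'M[C]_(m * n, k)) :
  lift_ptrace1 ((u *t v) *m M) = v *m lift_ptrace1 M *m (u^T *t 1%:M).
Proof.
apply/matrixP => e j; case: (mxtens_indexP j) => a c.
rewrite [LHS]mxE !mxtens_indexK [LHS]mxE [LHS]big_mxtens [RHS]mxE [RHS]big_mxtens.
apply: eq_bigr => b _; symmetry.
rewrite (eq_bigr (fun d => (1%:M : 'M[C]_k) c d *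
  (\sum_f v e f * M (mxtens_index (b, f)) d * u a b))); last first.
  move=> d _; rewrite tensmxE mxE mulr_suml mulr_sumr; apply: eq_bigr => f _.
  by rewrite !mxE mxtens_indexK eq_sym; ring.
by rewrite sum_scalar1; apply: eq_bigr => f _; rewrite tensmxE; ring.
Qed.

Lemma tens1 m n : (1%:M : 'M[C]_m) *t (1%:M : 'M[C]_n) = 1%:M.
Proof.
by apply: mxtens_matrixP => a b c d; rewrite tensmxE !mxE eq_mxtens_index -natrM mulnb.
Qed.

Lemma ptrace1_conj m n (u : 'M[C]_m) (v : 'M[C]_n) (A : 'M[C]_(m * n)) :
  u \is unitarymx -> psdmx A ->
  ptrace1 ((u *t v) *m A *m (u *t v)^t*) = v *m ptrace1 A *m v^t*.
Proof.
move=> uu /psd_gramP[M ->].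
have -> : (u *t v) *m (M *m M^t*) *m (u *t v)^t* = (u *t v) *m M *m ((u *t v) *m M)^t*.
  by rewrite adjmx_mul !mulmxA.
rewrite -!lift_ptrace1_gram lift_ptrace1_mul; set T := _ *t 1%:M.
rewrite adjmx_mul !mulmxA -[_ *m T *m _]mulmxA.
have -> : T *m T^t* = 1%:M.
  rewrite adjmx_tens tensmx_mul adjmx1 mulmx1.
  have /unitarymxP -> : u^T \is unitarymx by rewrite trmx_unitary.
  exact: tens1.
by rewrite mulmx1 adjmx_mul !mulmxA.
Qed.

Lemma tens_unitary m n (u : 'M[C]_m) (v : 'M[C]_n) :
  u \is unitarymx -> v \is unitarymx -> u *t v \is unitarymx.
Proof.
move=> /unitarymxP uu /unitarymxP vv; apply/unitarymxP.
by rewrite adjmx_tens tensmx_mul uu vv tens1.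
Qed.

Lemma unitarymx_adjmul n (u : 'M[C]_n) : u \is unitarymx -> u^t* *m u = 1%:M.
Proof. by move=> /unitarymxP/mulmx1C. Qed.

Section Channel.
Variables (dA dE dA' d1 d2 : nat) (sigma : 'M[C]_dA').
Variable W : 'M[C]_((d1 * d2) * dE, (dA * dA') * dE).

Definition decoupling_channel (rho : 'M[C]_(dA * dE)) : 'M[C]_(d1 * dE) :=
  ptrace_mid (W *m add_ancilla rho sigma *m W^t*).

Hypothesis state_sigma : state sigma.
Hypothesis W_isometry : W^t* *m W = 1%:M.

(** A Stinespring dilation on purifications, linear in [M]; its cross Gram matrices are the channel
    applied to [M N^*]. *)
Definition lift_channel k (M : 'M[C]_(dA * dE, k)) : 'M[C]_(d1 * dE, d2 * (k * dA')) :=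
  lift_ptrace_mid (W *m lift_ancilla (fcalc sqrtC sigma) M).

Lemma lift_channel_gram k (M N : 'M[C]_(dA * dE, k)) :
  lift_channel M *m (lift_channel N)^t* = decoupling_channel (M *m N^t*).
Proof.
have [ps _] := state_sigma.
rewrite lift_ptrace_mid_gram adjmx_mul mulmxA -[_ *m _ *m (lift_ancilla _ N)^t*]mulmxA.
by rewrite lift_ancilla_gram (fcalc_sqrt_adj ps) (fcalc_sqrtK ps).
Qed.

Lemma mxtrace_decoupling_channel (X : 'M[C]_(dA * dE)) : \tr (decoupling_channel X) = \tr X.
Proof.
rewrite mxtrace_ptrace_mid mxtrace_mulC mulmxA W_isometry mul1mx mxtrace_add_ancilla.
by case: state_sigma => _ ->; rewrite mulr1.
Qed.

Lemma state_decoupling_channel (rho : 'M[C]_(dA * dE)) :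
  state rho -> state (decoupling_channel rho).
Proof.
move=> [/psd_gramP[M ->] t1]; split; last by rewrite mxtrace_decoupling_channel.
by rewrite -lift_channel_gram; exact: psd_gram.
Qed.

(** The channel preserves the trace of every matrix, in particular of the cross term [N M^*], so
    optimal purifications keep their overlap when lifted. *)
Lemma purified_dist_decoupling_channel (a b : 'M[C]_(dA * dE)) : state a -> state b ->
  purified_dist (decoupling_channel a) (decoupling_channel b) <= purified_dist a b.
Proof.
move=> [pa ta] [pb tb]; have [M [N [eM eN eMN]]] := fidelity_attained pa pb ta.
apply: le_purified_dist; first exact: fidelity_ge0.
rewrite -lecR -eMN -eM -eN -!lift_channel_gram; apply: le_trans (fidelity_ge _ _); last first.
  by rewrite lift_channel_gram mxtrace_decoupling_channel eM.
rewrite [X in `|X|]mxtrace_mulC lift_channel_gram mxtrace_decoupling_channel.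
rewrite [X in `|X|]mxtrace_mulC.
by rewrite eMN ger0_norm // ler0c fidelity_ge0.
Qed.

End Channel.

(** [u] is absorbed into the unitary [U]; [v] acts on [E] alone, commutes with the whole procedure
    and is undone on [omegaE]. *)
Lemma catalytic_decoupling_local_unitary dA dE (u : 'M[C]_dA) (v : 'M[C]_dE)
    (rho : 'M[C]_(dA * dE)) eps d2 (g := u *t v) :
  u \is unitarymx -> v \is unitarymx -> state rho ->
  catalytic_decoupling (g *m rho *m g^t*) eps d2 -> catalytic_decoupling rho eps d2.
Proof.
move=> uu uv srho [dA' [d1 [sigma [V [U [omega1 [omegaE [ss [uV uV'] uU [s1 sE] le_eps]]]]]]]].
have uv' : v^t* \is unitarymx by rewrite trmxC_unitary.
have vv : v^t*^t* *m v^t* = 1%:M by apply: unitarymx_adjmul.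
exists dA', d1, sigma, V, (U *m (u *t 1%:M)), omega1, (v^t* *m omegaE *m v^t*^t*).
have u1 : u *t (1%:M : 'M[C]_dA') \is unitarymx.
  by rewrite tens_unitary //; apply/unitarymxP; rewrite adjmx1 mulmx1.
have uU' : U *m (u *t 1%:M) \is unitarymx by rewrite mul_unitarymx.
have sE' := state_isometry vv sE.
refine (And5 ss (conj uV uV') uU' (conj s1 sE') _).
set W' := _ *t _.
pose h : 'M[C]_(d1 * dE) := 1%:M *t v.
have uh : h^t* \is unitarymx.
  rewrite trmxC_unitary; apply: tens_unitary => //.
  by apply/unitarymxP; rewrite adjmx1 mulmx1.
have W'W' : W'^t* *m W' = 1%:M.
  rewrite adjmx_tens tensmx_mul adjmx1 mulmx1 -(tens1 (dA * dA') dE); congr (_ *t _).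
  have VV : V^t* *m V = 1%:M by have /unitarymxP := uV'; rewrite trmxCK.
  rewrite !adjmx_mul !mulmxA -[_ *m V^t* *m V]mulmxA VV mulmx1.
  rewrite -[_ *m U^t* *m U]mulmxA (unitarymx_adjmul uU) mulmx1.
  exact: unitarymx_adjmul u1.
pose X := decoupling_channel sigma W' rho.
have sX : state X by exact: state_decoupling_channel.
set Y := ptrace_mid _ in le_eps.
(* The output for the rotated state is the output [X] for [rho] rotated by [v] on [E]. *)
have eY : Y = h *m X *m h^t*.
  have [[prho _] [psig _]] := (srho, ss).
  rewrite /Y add_ancilla_conj // -ptrace_mid_conj; last first.
    have [M eM] := psd_gramP prho; have [B eB] := psd_gramP psig.
    by rewrite eM eB -lift_ancilla_gram; apply/psd_conj/psd_gram.
  congr ptrace_mid; set A := add_ancilla _ _.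
  set W := (V *m U) *t _; set G := (u *t _) *t v.
  have e : W *m G = (1%:M *t v) *m W'.
    by rewrite /W /G /W' !tensmx_mul !mul1mx mulmx1 !mulmxA.
  have -> : W *m (G *m A *m G^t*) *m W^t* = (W *m G) *m A *m (W *m G)^t*.
    by rewrite adjmx_mul !mulmxA.
  by rewrite e adjmx_mul !mulmxA.
have sY : state Y.
  by rewrite eY; apply: state_isometry => //; have /unitarymxP := uh; rewrite trmxCK.
have sO : state (omega1 *t omegaE).
  case: s1 sE => [/psd_gramP[M ->] t1] [/psd_gramP[N ->] tE]; split.
    by rewrite -tensmx_mul -adjmx_tens; exact: psd_gram.
  by rewrite mxtrace_tens t1 tE mulr1.
apply: le_trans le_eps.
have -> : ptrace_mid (W' *m add_ancilla rho sigma *m W'^t*) = h^t* *m Y *m h^t*^t*.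
  have hh : h^t* *m h = 1%:M by have /unitarymxP := uh; rewrite trmxCK.
  by rewrite trmxCK eY !mulmxA hh mul1mx -[_ *m h^t* *m h]mulmxA hh mulmx1.
have -> : omega1 *t (v^t* *m omegaE *m v^t*^t*) = h^t* *m (omega1 *t omegaE) *m h^t*^t*.
  by rewrite !adjmx_tens !adjmx1 !tensmx_mul !mul1mx mulmx1.
by apply: purified_dist_isometry => //; exact: unitarymx_adjmul.
Qed.

End Decoupling.

(** * Decoupling by a swap controlled in a Bell basis *)

Section Swap.
Variables (J : finType) (A : eqType).

(** Undoes the swap on basis labels: if [z] is the configuration after [A] and site [j] are
    exchanged, [A] held [z (Some j)] before and the copies held this. *)
Definition swapped_out (j : J) (z : {ffun option J -> A}) : {ffun J -> A} :=
  [ffun i => if i == j then z None else z (Some i)].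

Lemma swapped_out_inj (j : J) (z z' : {ffun option J -> A}) :
  (z (Some j) == z' (Some j)) && (swapped_out j z == swapped_out j z') = (z == z').
Proof.
apply/andP/eqP => [[/eqP ej /eqP/ffunP e]|->//].
apply/ffunP => -[i|]; last by have := e j; rewrite !ffunE eqxx.
have [->//|ne] := eqVneq i j.
by have := e i; rewrite !ffunE (negbTE ne).
Qed.

Lemma prod_swapped_out (C : comNzRingType) (j : J) (F : A -> A -> C) z z' :
  \prod_i F (swapped_out j z i) (swapped_out j z' i) =
  \prod_(o | o != Some j) F (z o) (z' o).
Proof.
rewrite [RHS](reindex_omap (fun i => if i == j then None else Some i)
  (fun o => if o is Some i then Some i else Some j)) /=.
  apply: eq_big => i.
    have [->|ne] := eqVneq i j; first by rewrite /= eqxx.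
    by rewrite /= (inj_eq Some_inj) ?ne ?eqxx.
  by move=> _; rewrite !ffunE; case: eqP.
case=> [i|] /=; last by rewrite eqxx.
by rewrite (inj_eq Some_inj) => /negbTE ->.
Qed.

End Swap.

Lemma big_enum_rank (C : nmodType) (T : finType) (F : 'I_#|T| -> C) :
  \sum_i F i = \sum_t F (enum_rank t).
Proof. exact: (reindex _ (onW_bij _ (@enum_rank_bij T))). Qed.

Lemma big_enum_rank_prod (C : nmodType) (T U : finType) (F : 'I_#|{: T * U}| -> C) :
  \sum_i F i = \sum_t \sum_u F (enum_rank (t, u)).
Proof. by rewrite big_enum_rank pair_big; apply: eq_bigr => -[]. Qed.

Lemma diag_tens (C : numClosedFieldType) m n (u : 'rV[C]_m) (v : 'rV[C]_n) :
  diag_mx u *t diag_mx v =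
  diag_mx (\row_i (u 0 (mxtens_unindex i).1 * v 0 (mxtens_unindex i).2)).
Proof.
apply: mxtens_matrixP => a b c d; rewrite tensmxE !mxE eq_mxtens_index !mxtens_indexK /=.
by case: (a == c); case: (b == d); rewrite ?mulr0n ?mulr1n ?(mul0r, mulr0).
Qed.

(** * The catalyst, its unitary and the resulting state *)

Section Construction.
Variable R : realType.
Local Notation C := R[i].
Variables (X J : finType) (phi : J -> X -> X -> C).
Hypothesis card_J : #|J| = (#|X| * #|X|)%N.
Hypothesis card_X : (0 < #|X|)%N.
Hypothesis phi_basis : forall k l k' l',
  \sum_j phi j k l * (phi j k' l')^* = ((k == k') && (l == l'))%:R.
Hypothesis phi_entangled : forall j k k',
  \sum_l phi j k l * (phi j k' l)^* = (k == k')%:R / #|X|%:R.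
Variables (dA dE : nat).

(** [T'] labels the ancilla (copies and index register). [T1] labels the kept system [A1] (all sites
    and one half of the rotated register); the other half, of dimension [#|X|], is [A2]. *)
Let T' : finType := ({ffun J -> 'I_dA} * J)%type.
Let T1 : finType := ({ffun option J -> 'I_dA} * X)%type.

(* The basis vector of register index [j] goes to [phi j], controlling a swap of [A] with
   site [j]; after the swap, site [None] is the original position of [A]. *)
Definition swap_bell_mx : 'M[C]_(#|T1| * #|X|, dA * #|T'|) :=
  \matrix_(i, q)
    let zk : T1 := enum_val (mxtens_unindex i).1 in
    let yj : T' := enum_val (mxtens_unindex q).2 in
    phi yj.2 zk.2 (enum_val (mxtens_unindex i).2) *
      (((mxtens_unindex q).1 == zk.1 (Some yj.2)) && (yj.1 == swapped_out yj.2 zk.1))%:R.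

Let row_idx (z : {ffun option J -> 'I_dA}) k (l : X) : 'I_(#|T1| * #|X|) :=
  mxtens_index (enum_rank ((z, k) : T1), enum_rank l).

Let col_idx (b : 'I_dA) y j : 'I_(dA * #|T'|) :=
  mxtens_index (b, enum_rank ((y, j) : T')).

Let swap_bell_mxE z k l b y j :
  swap_bell_mx (row_idx z k l) (col_idx b y j) =
  phi j k l * ((b == z (Some j)) && (y == swapped_out j z))%:R.
Proof. by rewrite mxE !mxtens_indexK /= !enum_rankK. Qed.

Let swap_bell_sum z k l (G : 'I_(dA * #|T'|) -> C) :
  \sum_q swap_bell_mx (row_idx z k l) q * G q =
  \sum_j phi j k l * G (col_idx (z (Some j)) (swapped_out j z) j).
Proof.
rewrite big_mxtens exchange_big big_enum_rank_prod exchange_big; apply: eq_bigr => j _.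
rewrite (bigD1 (swapped_out j z)) //= [X in _ + X]big1 ?addr0; last first.
  move=> y ne; rewrite big1 // => b _; rewrite swap_bell_mxE (negbTE ne) andbF.
  by rewrite mulr0 mul0r.
rewrite (bigD1 (z (Some j))) //= [X in _ + X]big1 ?addr0; last first.
  by move=> b ne; rewrite swap_bell_mxE (negbTE ne) mulr0 mul0r.
by rewrite swap_bell_mxE !eqxx mulr1.
Qed.

Lemma swap_bell_mx_adj : swap_bell_mx *m swap_bell_mx^t* = 1%:M.
Proof.
apply/matrixP => i i'; case: (mxtens_indexP i) => zk l; case: (mxtens_indexP i') => zk' l'.
rewrite -(enum_valK zk) -(enum_valK zk') -(enum_valK l) -(enum_valK l').
move: (enum_val zk) (enum_val zk') (enum_val l) (enum_val l').
move=> {zk zk' l l' i i'} [z k] [z' k'] l l'.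
rewrite -/(row_idx z k l) -/(row_idx z' k' l') mxE (eq_bigr (fun q =>
  swap_bell_mx (row_idx z k l) q * (swap_bell_mx (row_idx z' k' l') q)^*)); last first.
  by move=> q _; rewrite !mxE.
rewrite swap_bell_sum; under eq_bigr => j _ do
  rewrite swap_bell_mxE rmorphM rmorph_nat swapped_out_inj mulrA.
rewrite -mulr_suml phi_basis [RHS]mxE eq_mxtens_index !(inj_eq enum_rank_inj) xpair_eqE.
by rewrite -natrM mulnb; congr (nat_of_bool _)%:R; case: (z == z'); rewrite ?andbT ?andbF.
Qed.

(** The matrix is square because [#|J| = #|X|^2], so a one-sided inverse is two-sided. *)
Lemma adj_swap_bell_mx : swap_bell_mx^t* *m swap_bell_mx = 1%:M.
Proof.
apply: mul_adj_eqdim swap_bell_mx_adj.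
rewrite !card_prod !card_ffun card_option card_ord card_J expnS.
by rewrite -!mulnA.
Qed.

Let W : 'M[C]_((#|T1| * #|X|) * dE, (dA * #|T'|) * dE) := swap_bell_mx *t 1%:M.

Let W_sum i e (G : 'I_((dA * #|T'|) * dE) -> C) :
  \sum_q W (mxtens_index (i, e)) q * G q =
  \sum_q swap_bell_mx i q * G (mxtens_index (q, e)).
Proof.
rewrite big_mxtens; apply: eq_bigr => q _.
rewrite (eq_bigr (fun f => (e == f)%:R * (swap_bell_mx i q * G (mxtens_index (q, f))))).
  by rewrite sum_eq_mulr.
by move=> f _; rewrite tensmxE [1%:M _ _]mxE; ring.
Qed.

Let W_conjE z k l e z' k' l' f (B : 'M[C]_((dA * #|T'|) * dE)) :
  (W *m B *m W^t*) (mxtens_index (row_idx z k l, e)) (mxtens_index (row_idx z' k' l', f)) =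
  \sum_j \sum_j' phi j k l * (phi j' k' l')^* *
    B (mxtens_index (col_idx (z (Some j)) (swapped_out j z) j, e))
      (mxtens_index (col_idx (z' (Some j')) (swapped_out j' z') j', f)).
Proof.
rewrite -mulmxA mxE W_sum swap_bell_sum; apply: eq_bigr => j _.
rewrite mxE -[X in _ * X]conjCK rmorph_sum /=.
under eq_bigr => q _ do rewrite rmorphM mulrC adjmxE /= conjCK.
rewrite W_sum swap_bell_sum rmorph_sum mulr_sumr; apply: eq_bigr => j' _.
by rewrite rmorphM /= conjCK; ring.
Qed.

Variables (s : 'rV[C]_dA) (p : 'rV[C]_dE).
Hypotheses (s0 : forall a, 0 <= s 0 a) (s1 : \sum_a s 0 a = 1).
Hypotheses (p0 : forall e, 0 <= p 0 e) (p1 : \sum_e p 0 e = 1).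

Definition split_ancilla : 'M[C]_#|T'| :=
  diag_mx (\row_t (\prod_i s 0 ((enum_val t : T').1 i) / #|J|%:R)).

Definition split_omega : 'M[C]_#|T1| :=
  diag_mx (\row_t (\prod_i s 0 ((enum_val t : T1).1 i) / #|X|%:R)).

Let sum_prod_ffun (I : finType) : \sum_(z : {ffun I -> 'I_dA}) \prod_i s 0 (z i) = 1.
Proof.
rewrite -(bigA_distr_bigA (fun (i : I) a => s 0 a)) big1 // => i _; exact: s1.
Qed.

Let J_gt0 : (0 < #|J|)%N.
Proof. by rewrite card_J muln_gt0 card_X. Qed.

Lemma state_split_ancilla : state split_ancilla.
Proof.
split.
  by apply: psd_diag_mx => i; rewrite mxE divr_ge0 ?prodr_ge0 // ler0n.
rewrite mxtrace_diag big_enum_rank_prod.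
under eq_bigr do under eq_bigr do rewrite mxE enum_rankK /=.
under eq_bigr do rewrite sumr_const -mulrnAr -mulr_natl divff ?pnatr_eq0 -?lt0n // mulr1.
exact: sum_prod_ffun.
Qed.

Lemma state_split_omega : state split_omega.
Proof.
split.
  by apply: psd_diag_mx => i; rewrite mxE divr_ge0 ?prodr_ge0 // ler0n.
rewrite mxtrace_diag big_enum_rank_prod.
under eq_bigr do under eq_bigr do rewrite mxE enum_rankK /=.
under eq_bigr do rewrite sumr_const -mulrnAr -mulr_natl divff ?pnatr_eq0 -?lt0n // mulr1.
exact: sum_prod_ffun.
Qed.

Variable rho : 'M[C]_(dA * dE).
Let r a e b f := rho (mxtens_index (a, e)) (mxtens_index (b, f)).

(** The index register is diagonal, so only [j = j'] survives; tracing out [l] leaves the same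
    maximally mixed state on [k] for every [j]. The index is erased and the plain average
    remains. *)
Lemma split_channelE z k e z' k' f :
  decoupling_channel split_ancilla W rho
    (mxtens_index (enum_rank ((z, k) : T1), e)) (mxtens_index (enum_rank ((z', k') : T1), f)) =
  (k == k')%:R / #|X|%:R * split_average r (s 0) z z' e f.
Proof.
rewrite ptrace_midE big_enum_rank.
under eq_bigr => l _ do rewrite -/(row_idx z k l) -/(row_idx z' k' l) W_conjE.
rewrite exchange_big /split_average mulrCA mulr_sumr mulr_sumr; apply: eq_bigr => j _ /=.
rewrite (eq_bigr (fun l => phi j k l * (phi j k' l)^* *
   (#|J|%:R^-1 * split_term r (s 0) j z z' e f))).
  by rewrite -mulr_suml phi_entangled; ring.
move=> l _; rewrite (bigD1 j) //= big1 ?addr0; last first.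
  move=> j' ne; rewrite add_ancillaE !mxE (inj_eq enum_rank_inj) xpair_eqE.
  by rewrite [j == _]eq_sym (negbTE ne) andbF mulr0n !mulr0.
congr (_ * _); rewrite add_ancillaE !mxE (inj_eq enum_rank_inj) xpair_eqE eqxx andbT enum_rankK /=.
rewrite -[_ *+ (_ == _)]mulr_natr ffun_eq_prod [X in _ * X]mulrAC -big_split /=.
rewrite (prod_swapped_out j (fun a b => s 0 a * (a == b)%:R)).
rewrite /split_term [in RHS](bigD1 (Some j)) //= {1}/split_factor eqxx.
rewrite [in RHS](eq_bigr (fun i => s 0 (z i) * (z i == z' i)%:R)); last first.
  by move=> i /negbTE ni; rewrite /split_factor ni.
by rewrite /r; ring.
Qed.

Variable K : R.
Hypotheses (K0 : 0 <= K) (state_rho : state rho) (marginal_rho : ptrace1 rho = diag_mx p).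
Hypothesis rho_le : psdmx (K%:C *: (diag_mx s *t diag_mx p) - rho).

Let w : 'rV[C]_(dA * dE) := \row_i (s 0 (mxtens_unindex i).1 * p 0 (mxtens_unindex i).2).

Let wE a e : w 0 (mxtens_index (a, e)) = s 0 a * p 0 e.
Proof. by rewrite mxE mxtens_indexK. Qed.

Let dom_rho : psd (K%:C *: diag_mx w - rho).
Proof. by rewrite -diag_tens. Qed.

Let r_supp a e b f : s 0 a = 0 -> r a e b f = 0.
Proof.
by move=> sa; apply: (dominated_support state_rho.1 dom_rho); rewrite wE sa mul0r.
Qed.

Let r_supp_p a e b f : p 0 e = 0 -> r a e b f = 0.
Proof.
by move=> pe; apply: (dominated_support state_rho.1 dom_rho); rewrite wE pe mulr0.
Qed.

Let r_marginal e f : \sum_a r a e a f = (e == f)%:R * p 0 e.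
Proof.
have := congr1 (fun M : 'M[C]_dE => M e f) marginal_rho.
by rewrite !mxE => ->; rewrite mulr_natl.
Qed.

Let r_sum_le :
  \sum_a \sum_e \sum_b \sum_f `|r a e b f| ^+ 2 / (s 0 a * p 0 e) <= K%:C.
Proof.
have w0 i : 0 <= w 0 i by rewrite mxE mulr_ge0.
have := dominated_sum_le state_rho.1 w0 dom_rho.
rewrite ler0c state_rho.2 mulr1 => /(_ K0); apply: le_trans.
rewrite big_mxtens le_eqVlt; apply/orP; left; apply/eqP.
apply: eq_bigr => a _; apply: eq_bigr => e _; rewrite big_mxtens.
by apply: eq_bigr => b _; apply: eq_bigr => f _; rewrite wE.
Qed.

Let split_average_supp (z z' : {ffun option J -> 'I_dA}) e f :
  (\prod_i s 0 (z i)) * p 0 e = 0 -> split_average r (s 0) z z' e f = 0.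
Proof.
move=> /eqP; rewrite mulf_eq0 => h; rewrite /split_average big1 ?mulr0 // => j _.
have {h} [[i si]|pe] : (exists i, s 0 (z i) = 0) \/ p 0 e = 0.
- by case/orP: h => [/prodf_eq0[i _ /eqP]|/eqP]; [left; exists i|right].
- rewrite /split_term (bigD1 i) //= {1}/split_factor.
  by case: eqP => _; rewrite ?r_supp ?si ?mul0r.
- rewrite /split_term (bigD1 (Some j)) //= {1}/split_factor eqxx.
  by rewrite r_supp_p ?mul0r.
Qed.

(** The collision sum is at most [1 + K / #|J|], hence at most [1 + q^2]. *)
Lemma purified_dist_split_channel (q : R) : 0 <= q -> K <= q ^+ 2 * #|J|%:R ->
  purified_dist (decoupling_channel split_ancilla W rho) (split_omega *t diag_mx p) <= q.
Proof.
move=> q0 hK; have d0 : #|X|%:R != 0 :> C by rewrite pnatr_eq0 -lt0n.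
have [_ tO] := state_split_omega.
rewrite diag_tens; set om := \row_i _.
have omE z k e : om 0 (mxtens_index (enum_rank ((z, k) : T1), e)) =
    \prod_i s 0 (z i) / #|X|%:R * p 0 e.
  by rewrite mxE mxtens_indexK /= mxE enum_rankK.
have WW : W^t* *m W = 1%:M.
  by rewrite adjmx_tens tensmx_mul adj_swap_bell_mx adjmx1 mulmx1 tens1.
have st := state_decoupling_channel state_split_ancilla WW state_rho.
apply: purified_dist_diag_le => //.
- move=> i; case: (mxtens_indexP i) => zk e.
  by rewrite -(enum_valK zk); case: (enum_val zk) => z k; rewrite omE !mulr_ge0 ?prodr_ge0 ?invr_ge0.
- rewrite -[RHS]mulr1 -{1}tO -p1 mxtrace_diag big_mxtens mulr_suml; apply: eq_bigr => zk _.
  by rewrite mulr_sumr; apply: eq_bigr => e _; rewrite mxE mxtens_indexK.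
- move=> i j; case: (mxtens_indexP i) => zk e; case: (mxtens_indexP j) => zk' f.
  rewrite -(enum_valK zk) -(enum_valK zk'); case: (enum_val zk) => z k.
  case: (enum_val zk') => z' k'; rewrite omE split_channelE mulrAC => /eqP.
  by rewrite mulf_eq0 invr_eq0 (negbTE d0) orbF => /eqP/split_average_supp ->; rewrite mulr0.
have n0 : 0 < #|J|%:R :> C by rewrite ltr0n.
apply: (@le_trans _ _ (1 + K%:C / #|J|%:R)); last first.
  rewrite rmorphD rmorph1 lerD2l ler_pdivrMr // -[#|J|%:R](rmorph_nat (real_complex R)).
  by rewrite -rmorphM lecR.
apply: le_trans (split_average_sum_le s0 s1 p0 p1 r_supp r_marginal J_gt0 _ r_sum_le); last first.
  by rewrite ler0c.
rewrite le_eqVlt; apply/orP; left; apply/eqP.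
rewrite big_mxtens exchange_big; apply: eq_bigr => e _ /=.
under eq_bigr => zk _ do rewrite big_mxtens exchange_big /=.
rewrite exchange_big; apply: eq_bigr => f _ /=.
rewrite big_enum_rank_prod; apply: eq_bigr => z _.
under [LHS]eq_bigr => k _ do rewrite big_enum_rank_prod.
rewrite exchange_big; apply: eq_bigr => z' _ /=.
set t := split_average r (s 0) z z' e f.
(* The kept half register contributes [#|X|] diagonal terms, each [#|X|^-2] over the weight
   [#|X|^-1]; they sum to 1 and drop out. *)
rewrite (eq_bigr (fun=> `|t| ^+ 2 / (\prod_i s 0 (z i) * p 0 e) / #|X|%:R)); last first.
  move=> k _; rewrite (eq_bigr (fun k' => (k == k')%:R *
     (`|t| ^+ 2 / (\prod_i s 0 (z i) * p 0 e) / #|X|%:R))).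
    by rewrite sum_eq_mulr.
  move=> k' _; rewrite omE split_channelE -/t !normrM !normr_nat normfV normr_nat !exprMn.
  rewrite !invfM invrK; case: (k == k'); last by rewrite !expr0n !mul0r.
  rewrite expr1n !mul1r; move: d0 (\prod_i s 0 (z i))^-1 (p 0 e)^-1.
  by move: (#|X|%:R) => d dn u v; field.
by rewrite sumr_const -[LHS]mulr_natr divfK.
Qed.

Lemma convex_split_decoupling (rhoh : 'M[C]_(dA * dE)) (e q : R) : state rhoh ->
  purified_dist rhoh rho <= e -> 0 <= q -> K <= q ^+ 2 * #|J|%:R ->
  catalytic_decoupling rhoh (e + q) #|X|.
Proof.
move=> srh le_e q0 hK.
have V1 : swap_bell_mx *m (1%:M : 'M[C]_(dA * #|T'|)) = swap_bell_mx by rewrite mulmx1.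
(* The whole operation sits in the isomorphism [V], and [U] is the identity. *)
exists #|T'|, #|T1|, split_ancilla, swap_bell_mx, 1%:M, split_omega, (diag_mx p).
rewrite /= V1 -/W; have sp : state (diag_mx p).
  by rewrite -marginal_rho; exact: state_ptrace1.
have sO : state (split_omega *t diag_mx p).
  case: state_split_omega sp => [/psd_gramP[M ->] t1] [/psd_gramP[N ->] tE]; split.
    by rewrite -tensmx_mul -adjmx_tens; exact: psd_gram.
  by rewrite mxtrace_tens t1 tE mulr1.
have WW : W^t* *m W = 1%:M.
  by rewrite adjmx_tens tensmx_mul adj_swap_bell_mx adjmx1 mulmx1 tens1.
split; first exact: state_split_ancilla.
- split; apply/unitarymxP; first exact: swap_bell_mx_adj.
  by rewrite trmxCK; exact: adj_swap_bell_mx.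
- by apply/unitarymxP; rewrite adjmx1 mulmx1.
- by split => //; exact: state_split_omega.
have sc X0 : state X0 -> state (decoupling_channel split_ancilla W X0).
  by move=> h; have := state_decoupling_channel state_split_ancilla WW h.
apply: le_trans (purified_dist_triangle (sc _ srh) (sc _ state_rho) sO) _.
apply: lerD; last exact: purified_dist_split_channel.
apply: le_trans le_e.
by have := purified_dist_decoupling_channel state_split_ancilla WW srh state_rho.
Qed.

End Construction.

(** * The smooth max-information and the main estimate *)

Section Imax.
Variable R : realType.
Local Notation C := R[i].

Lemma psd_add n (A B : 'M[C]_n) : psdmx A -> psdmx B -> psdmx (A + B).
Proof.
move=> [/hermsymmxP hA pA] [/hermsymmxP hB pB]; split.
  by apply/hermsymmxP; rewrite linearD /= map_mxD hA hB.
by move=> v; rewrite mulmxDr mulmxDl mxE addr_ge0.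
Qed.

Lemma psd_scale n (c : C) (A : 'M[C]_n) : 0 <= c -> psdmx A -> psdmx (c *: A).
Proof.
move=> c0 [/hermsymmxP hA pA]; split.
  by apply/hermsymmxP; rewrite adjmx_scale hA (CrealP (ger0_real c0)).
by move=> v; rewrite -scalemxAr -scalemxAl mxE mulr_ge0.
Qed.

Lemma psd_tens m n (A : 'M[C]_m) (B : 'M[C]_n) : psdmx A -> psdmx B -> psdmx (A *t B).
Proof.
move=> /psd_gramP[M ->] /psd_gramP[N ->].
by rewrite -tensmx_mul -adjmx_tens; exact: psd_gram.
Qed.

Lemma psd_mxtrace_eq0 n (A : 'M[C]_n) : psdmx A -> \tr A = 0 -> A = 0.
Proof. by move=> /psd_gramP[M ->] /mxtrace_gram_eq0 ->; rewrite mul0mx. Qed.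

Lemma psd_le_scale n (a b : R) (A B : 'M[C]_n) : a <= b -> psdmx B ->
  psdmx (a%:C *: B - A) -> psdmx (b%:C *: B - A).
Proof.
move=> le_ab pB h; have -> : b%:C *: B - A = (b - a)%:C *: B + (a%:C *: B - A).
  by rewrite rmorphB scalerBl addrA subrK.
have ba : 0 <= (b - a)%:C by rewrite ler0c subr_ge0.
exact: psd_add (psd_scale ba pB) h.
Qed.

Lemma state_uniform n : (0 < n)%N -> state ((n%:R^-1)%:M : 'M[C]_n).
Proof.
move=> n0; split.
  rewrite -diag_const_mx; apply: psd_diag_mx => i.
  by rewrite mxE invr_ge0 ler0n.
by rewrite mxtrace_scalar -[LHS]mulr_natr mulVf // pnatr_eq0 -lt0n.
Qed.

Lemma state_dim_gt0 m n (rho : 'M[C]_(m * n)) : state rho -> (0 < m)%N.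
Proof.
case: m rho => // rho [_ /eqP]; rewrite /mxtrace big_mxtens big_ord0.
by rewrite eq_sym oner_eq0.
Qed.

(** Gives finiteness of [Imax]. With [rho = M M^*] and [x a b c] the pairing of block [a] of [v]
    with block [b] of [M], Cauchy-Schwarz bounds the square of a sum of [m] diagonal terms by [m]
    times the sum of squares, and the right-hand side contains all pairs of blocks. *)
Lemma psd_sub_ptrace1 m n (rho : 'M[C]_(m * n)) : psdmx rho ->
  psdmx (m%:R *: (1%:M *t ptrace1 rho) - rho).
Proof.
move=> prho; have [M eM] := psd_gramP prho.
pose L := (1%:M : 'M[C]_m) *t lift_ptrace1 M.
have eL : L *m L^t* = 1%:M *t ptrace1 rho.
  by rewrite adjmx_tens tensmx_mul adjmx1 mulmx1 lift_ptrace1_gram -eM.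
rewrite -eL; have pL := psd_gram L.
split.
  apply/hermsymmxP; rewrite adjmx_sub adjmx_scale (psd_adj prho) (psd_adj pL).
  by rewrite rmorph_nat.
move=> v; rewrite mulmxBr mulmxBl mxE [X in _ + X]mxE subr_ge0 eM.
rewrite -scalemxAr -scalemxAl [X in _ <= X]mxE -!mxtrace11.
have e k (Z : 'M[C]_(_, k)) : v *m (Z *m Z^t*) *m v^t* = (v *m Z) *m (v *m Z)^t*.
  by rewrite adjmx_mul !mulmxA.
rewrite !e !mxtrace_gramE !big_ord1.
pose x a b c := \sum_e v 0 (mxtens_index (a, e)) * M (mxtens_index (b, e)) c.
have -> : \sum_c `|(v *m M) 0 c| ^+ 2 = \sum_c `|\sum_a x a a c| ^+ 2.
  by apply: eq_bigr => c _; rewrite mxE big_mxtens.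
have -> : \sum_j `|(v *m L) 0 j| ^+ 2 = \sum_a \sum_b \sum_c `|x a b c| ^+ 2.
  rewrite big_mxtens; apply: eq_bigr => a _; rewrite big_mxtens.
  apply: eq_bigr => b _; apply: eq_bigr => c _.
  rewrite mxE big_mxtens (eq_bigr (fun a' => (1%:M : 'M[C]_m) a a' * x a' b c)).
    by rewrite sum_scalar1.
  move=> a' _; rewrite /x mulr_sumr; apply: eq_bigr => e0 _.
  by rewrite tensmxE !mxE mxtens_indexK eq_sym; ring.
under [X in _ <= _ * X]eq_bigr do rewrite exchange_big /=.
rewrite [X in _ <= _ * X]exchange_big mulr_sumr; apply: ler_sum => c _ /=.
have -> : \sum_a x a a c = \sum_a x a a c * 1 by apply: eq_bigr => a _; rewrite mulr1.
have := CauchySchwarz_sum (fun a => x a a c) (fun=> 1).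
rewrite normr1 expr1n sumr_const card_ord mulrC => /le_trans; apply.
rewrite ler_wpM2l ?ler0n //; apply: ler_sum => a _.
by rewrite (bigD1 a) //= lerDl sumr_ge0 // => b _; rewrite exprn_ge0.
Qed.

Local Notation lowner_scaled rho sigma l :=
  (lownermx rho ((2 `^ l)%:C *: (sigma *t ptrace1 rho))).

Lemma Imax_le dA dE (rho : 'M[C]_(dA * dE)) sigma l :
  state sigma -> lowner_scaled rho sigma l -> (Imax rho <= l%:E)%E.
Proof.
move=> ss hl; apply: (@le_trans _ _ (Dmax rho (sigma *t ptrace1 rho))).
  by apply: ereal_inf_lbound; exists sigma.
by apply: ereal_inf_lbound; exists l.
Qed.

Lemma Imax_lt dA dE (rho : 'M[C]_(dA * dE)) x : (Imax rho < x)%E ->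
  exists sigma l, [/\ state sigma, lowner_scaled rho sigma l & (l%:E < x)%E].
Proof.
move=> /ereal_inf_lt[_ [sigma ss <-]] /ereal_inf_lt[_ [l hl <-] lx].
by exists sigma, l.
Qed.

(** Taking traces in the operator inequality gives [1 <= 2^l]. *)
Lemma Imax_ge0 dA dE (rho : 'M[C]_(dA * dE)) :
  psdmx rho -> rho != 0 -> (0 <= Imax rho)%E.
Proof.
move=> prho rho0; rewrite leNgt; apply/negP => /Imax_lt[sigma [l [[_ ts] hl l0]]].
have := psd_trace_ge0 hl.
rewrite linearB /= linearZ /= mxtrace_tens ts mul1r mxtrace_ptrace1 -{2}[\tr rho]mul1r -mulrBl.
have t0 : 0 < \tr rho.
  rewrite lt_def (psd_trace_ge0 prho) andbT; apply: contra rho0 => /eqP.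
  by move=> /(psd_mxtrace_eq0 prho) ->.
rewrite pmulr_lge0 // subr_ge0 -[1]/((1 : R)%:C) lecR; apply/negP; rewrite -ltNge.
rewrite -ltr_ln ?posrE ?powR_gt0 // ln1 ln_powR pmulr_llt0 ?ln_gt0 ?ltr1n //.
Qed.

Lemma Imax0 dA dE : (0 < dA)%N -> Imax (0 : 'M[C]_(dA * dE)) = -oo%E.
Proof.
move=> dA0; have le r : (Imax (0 : 'M[C]_(dA * dE)) <= r%:E)%E.
  apply: (Imax_le (state_uniform dA0)); rewrite /lownermx subr0.
  have p0 : psdmx (0 : 'M[C]_(dA * dE)).
    by have := psd_gram (0 : 'M[C]_(dA * dE)); rewrite mul0mx.
  apply: psd_scale; first by rewrite ler0c powR_ge0.
  by apply: psd_tens (psd_ptrace1 p0); case: (state_uniform dA0).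
case: (Imax _) le => [x h|h|//]; last by have := h 0.
by have := h (x - 1 : R)%R; rewrite lee_fin => ?; exfalso; lra.
Qed.

Lemma Imax_ltoo dA dE (rho : 'M[C]_(dA * dE)) : state rho -> (Imax rho < +oo)%E.
Proof.
move=> [prho trho]; have dA0 := state_dim_gt0 (conj prho trho).
have ss := state_uniform dA0.
(* One factor [dA] comes from [psd_sub_ptrace1] and one from the normalization of the uniform state;
   [dA^2 <= 2^(dA + dA)]. *)
apply: (@le_lt_trans _ _ ((dA + dA)%:R%:E)%E); last exact: ltry.
apply: (Imax_le ss); rewrite /lownermx powR_mulrn ?ler0n //.
have -> : (dA%:R^-1)%:M *t ptrace1 rho = dA%:R^-1 *: ((1%:M : 'M[C]_dA) *t ptrace1 rho).
  apply: mxtens_matrixP => a b c d; rewrite [RHS]mxE !tensmxE !mxE.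
  by case: (a == c); rewrite ?mulr1n ?mulr0n ?mul0r ?mulr0 ?mul1r.
have -> : (2 ^+ (dA + dA))%:C *: (dA%:R^-1 *: ((1%:M : 'M[C]_dA) *t ptrace1 rho)) =
    (2 ^+ (dA + dA) / dA%:R)%:C *: ((1%:M : 'M[C]_dA) *t ptrace1 rho).
  by rewrite scalerA rmorphM /= fmorphV rmorph_nat.
have := psd_sub_ptrace1 prho; rewrite -(rmorph_nat (real_complex R)) => h.
apply: psd_le_scale h.
  rewrite ler_pdivlMr ?ltr0n // -natrM -natrX ler_nat expnD leq_mul // ltnW // ltn_expl //.
apply: psd_tens; last exact: psd_ptrace1.
by have := psd_gram (1%:M : 'M[C]_dA); rewrite mul1mx adjmx1.
Qed.

Section Smoothing.
Variables (dA dE : nat) (rho : 'M[C]_(dA * dE)) (e : R).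
Hypotheses (srho : state rho).

Let infimum := ereal_inf [set Imax rhob | rhob in purified_ball e rho].

Lemma smooth_Imax_fin_num : 0 <= e -> e < 1 -> (0 <= infimum < +oo)%E.
Proof.
move=> e0 e1; apply/andP; split.
  apply: le_ereal_inf_tmp => _ [rhob [[prhob _] hP] <-]; apply: Imax_ge0 => //.
  by apply: contraTneq hP => ->; rewrite purified_dist0 // -ltNge.
apply: le_lt_trans (Imax_ltoo srho); apply: ereal_inf_lbound; exists rho => //.
have [prho trho] := srho; split; first by split=> //; rewrite trho.
apply: le_trans e0; rewrite -[leRHS]sqrtr0 ler_wsqrtr // subr_le0.
(* [rho] lies in its own ball: the overlap of [G] with itself shows that its self-fidelity is at
   least 1. *)
have [G eG] := psd_gramP prho.
have := @fidelity_ge _ _ _ G G; rewrite -eG trho mxtrace_mulC -eG trho normr1 => /(_ erefl).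
rewrite -[1]/((1 : R)%:C) lecR => h.
by rewrite -(expr1n _ 2) ler_pXn2r ?nnegrE // (le_trans _ h).
Qed.

(** For radius at least 1 the ball contains 0, the infimum is [-oo] and [fine] returns 0. *)
Lemma smooth_Imax_ge0 : 0 <= e -> 0 <= smooth_Imax e rho.
Proof.
move=> e0; have [e1|e1] := ltrP e 1.
  by have /andP[h _] := smooth_Imax_fin_num e0 e1; exact: fine_ge0.
suff : infimum = -oo%E by rewrite /smooth_Imax -/infimum => ->.
apply/eqP; rewrite -leeNy_eq -(Imax0 dE (state_dim_gt0 srho)).
apply: ereal_inf_lbound; exists 0 => //; split; last by rewrite purified_dist0.
split; last by rewrite mxtrace0 ler01.
by have := psd_gram (0 : 'M[C]_(dA * dE)); rewrite mul0mx.
Qed.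

(** The slack 1 replaces attainment of the infima; it enlarges [K] by a factor 2, half a bit in the
    end. *)
Lemma smooth_Imax_witness : 0 <= e -> e < 1 ->
  exists rhob sigma l, [/\ substate rhob, purified_dist rho rhob <= e, state sigma,
    lowner_scaled rhob sigma l & l < smooth_Imax e rho + 1].
Proof.
move=> e0 e1; have /andP[ge0 ltoo] := smooth_Imax_fin_num e0 e1.
have fin : infimum \is a fin_num by rewrite ge0_fin_numE.
have [_ [rhob [srhob hP] <-]] := lb_ereal_inf_adherent (@ltr01 R) fin.
rewrite -/infimum -(fineK fin) -EFinD => /Imax_lt[sigma [l [ss hl]]].
by rewrite lte_fin => ll; exists rhob, sigma, l.
Qed.

End Smoothing.
End Imax.

(** * Constants and assembly of the bound *)

Section Achievability.
Variable R : realType.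
Local Notation C := R[i].

(** No purified distance exceeds 1, so nothing has to be done or removed. *)
Lemma catalytic_decoupling_trivial dA dE (rho : 'M[C]_(dA * dE)) (eps : R) :
  state rho -> 1 <= eps -> catalytic_decoupling rho eps 1.
Proof.
move=> srho eps1; have u1 n : (1%:M : 'M[C]_n) \is unitarymx.
  by apply/unitarymxP; rewrite adjmx1 mulmx1.
exists 1%N, dA, ((1%:R^-1)%:M), (1%:M : 'M[C]_(dA * 1)), 1%:M, ((dA%:R^-1)%:M), (ptrace1 rho).
split; rewrite ?adjmx1 //; first exact: state_uniform.
  by split; [exact/state_uniform/state_dim_gt0/srho|exact: state_ptrace1].
exact: le_trans (purified_dist_le1 _ _) eps1.
Qed.

Lemma sum_spectral_diag n (A : 'M[C]_n) : state A -> \sum_i spectral_diag A 0 i = 1.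
Proof.
move=> [pA tA]; rewrite -mxtrace_diag -(spectralmx_conj (psd_adj pA)).
by rewrite mxtrace_mulC mulmxA spectralmx_adj_mul mul1mx.
Qed.

Lemma ptrace1_scale m n (c : C) (A : 'M[C]_(m * n)) : ptrace1 (c *: A) = c *: ptrace1 A.
Proof.
by apply/matrixP => i j; rewrite !mxE mulr_sumr; apply: eq_bigr => k _; rewrite mxE.
Qed.

Lemma tensmx_scaler m n p q (c : C) (A : 'M[C]_(m, n)) (B : 'M[C]_(p, q)) :
  A *t (c *: B) = c *: (A *t B).
Proof. by apply/matrixP => i j; rewrite !mxE mulrCA. Qed.

(** Passing to eigenbases of [sigma] and of the marginal of [tau] makes the reference diagonal; the
    index register then consists of two registers of [m] bits. *)
Lemma catalytic_decoupling_dominated dA dE (rho : 'M[C]_(dA * dE)) tau sigma (K e q : R) m :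
  state rho -> state tau -> purified_dist rho tau <= e -> state sigma -> 0 <= K ->
  psdmx (K%:C *: (sigma *t ptrace1 tau) - tau) -> 0 <= q ->
  K <= q ^+ 2 * (2 ^+ m) ^+ 2 ->
  catalytic_decoupling rho (e + q) (2 ^ m).
Proof.
move=> srho stau le_e ssig K0 dom q0 hK.
have stE := state_ptrace1 stau.
pose u := spectralmx sigma; pose v := spectralmx (ptrace1 tau); pose g := u *t v.
have uu : u \is unitarymx := spectral_unitarymx _.
have uv : v \is unitarymx := spectral_unitarymx _.
have gg : g^t* *m g = 1%:M by exact: unitarymx_adjmul (tens_unitary uu uv).
pose X : finType := {ffun 'I_m -> bool}.
have cX : #|X| = (2 ^ m)%N by rewrite card_ffun card_bool card_ord.
rewrite -cX; apply: (catalytic_decoupling_local_unitary uu uv srho).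
have spec_ge0 n (A : 'M[C]_n) : state A -> forall i, 0 <= spectral_diag A 0 i.
  by move=> [pA _] i; exact: psd_spectral_ge0.
apply: (@convex_split_decoupling R X (X * X)%type (@bell_vector C m) _ _ _ _ dA dE
  (spectral_diag sigma) (spectral_diag (ptrace1 tau)) _ _ _ _ (g *m tau *m g^t*) K).
- by rewrite card_prod.
- by rewrite cX expn_gt0.
- exact: bell_basis.
- exact: bell_entangled.
- exact: spec_ge0.
- exact: sum_spectral_diag.
- exact: spec_ge0.
- exact: sum_spectral_diag.
- exact: K0.
- exact: state_isometry.
- by rewrite (ptrace1_conj _ uu stau.1) spectralmx_conj //; exact: psd_adj stE.1.
- rewrite -(spectralmx_conj (psd_adj ssig.1)) -(spectralmx_conj (psd_adj stE.1)).
  rewrite -/u -/v -!tensmx_mul -adjmx_tens -/g.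
  have := psd_conj g dom; rewrite mulmxBr mulmxBl -scalemxAr -scalemxAl.
  by [].
- exact: state_isometry.
- by apply: le_trans (purified_dist_isometry gg srho stau) le_e.
- exact: q0.
- by rewrite card_prod cX natrM natrX -expr2.
Qed.

Lemma state_normalize n (A : 'M[C]_n) (t : R) : psdmx A -> \tr A = t%:C -> 0 < t ->
  state ((t^-1)%:C *: A).
Proof.
move=> pA tA t0; split; first by apply: psd_scale => //; rewrite ler0c invr_ge0 ltW.
by rewrite linearZ /= tA -rmorphM mulVf ?rmorph1 // gt_eqF.
Qed.

Lemma catalytic_decoupling_smooth dA dE (rho : 'M[C]_(dA * dE)) (e q : R) m :
  state rho -> 0 <= e -> e < 1 -> 0 <= q ->
  2 `^ (smooth_Imax e rho + 1) <= q ^+ 2 * (2 ^+ m) ^+ 2 ->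
  catalytic_decoupling rho (e + q) (2 ^ m).
Proof.
move=> srho e0 e1 q0 hK.
have [rhob [sigma [l [[pb tb] hP ss hl ll]]]] := smooth_Imax_witness srho e0 e1.
have rhob0 : rhob != 0.
  by apply: contraTneq hP => ->; rewrite purified_dist0 // -ltNge.
pose t := complex.Re (\tr rhob).
have et : \tr rhob = t%:C := esym (ge0_ReK (psd_trace_ge0 pb)).
have t0 : 0 < t.
  rewrite lt_def -[_ <= _]ler0c -et (psd_trace_ge0 pb) andbT.
  apply: contra rhob0 => /eqP tz; rewrite (psd_mxtrace_eq0 pb) // et.
  by rewrite tz.
have t1 : t <= 1 by rewrite -lecR -et.
have st := state_normalize pb et t0.
apply: (catalytic_decoupling_dominated (sigma := sigma) srho st _ ss _ _ q0 hK).
- exact: le_trans (purified_dist_normalize srho pb t0 t1) hP.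
- exact: powR_ge0.
have ti : 0 <= (t^-1)%:C by rewrite ler0c invr_ge0 ltW.
(* Both sides of the domination are linear in the smoothed state, so normalizing it leaves [K]
   unchanged. *)
rewrite ptrace1_scale tensmx_scaler scalerA mulrC -scalerA -scalerBr.
apply: (psd_scale ti); apply: (fun le pB => psd_le_scale le pB hl).
  by rewrite ler_powR ?ler1n // ltW.
exact: psd_tens ss.1 (psd_ptrace1 pb).
Qed.

(** The 2 covers one bit for rounding to a power of two and half a bit for the slack in the infimum.
    The maximum keeps the overhead nonnegative for [d > 1], which can occur when the error is at
    least 1. *)
Definition log_overhead (d : R) : R := 2 + Num.max 0 (log2 d^-1).

Lemma log_overhead_bigO :
  log_overhead =O_ ((0 : R)^'+) (fun d : R => log2 d^-1).
Proof.
(* For [d < 1/2] the logarithm is at least 1 and absorbs the additive 2. *)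
apply/eqO_exP; exists 3 => //; near=> d.
have d0 : 0 < d by near: d; exact: nbhs_right_gt.
have d2 : d < 1 / 2 by near: d; apply: nbhs_right_lt; rewrite divr_gt0.
have ln2 : 0 < ln 2 :> R by rewrite ln_gt0 // ltr1n.
have h : 1 <= log2 d^-1.
  rewrite /log2 ler_pdivlMr // mul1r ler_ln ?posrE ?invr_gt0 //.
  by rewrite -[2]invrK lef_pV2 ?posrE ?invr_gt0 //; lra.
rewrite /log_overhead max_r; last by lra.
rewrite !ger0_norm; lra.
Unshelve. all: by end_near. Qed.

Lemma log2M (x y : R) : 0 < x -> 0 < y -> log2 (x * y) = log2 x + log2 y.
Proof. by move=> x0 y0; rewrite /log2 lnM ?posrE // mulrDl. Qed.

Lemma ler_log2 (x y : R) : 0 < x -> x <= y -> log2 x <= log2 y.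
Proof.
move=> x0 le; have ln2 : 0 < ln 2 :> R by rewrite ln_gt0 // ltr1n.
by rewrite ler_pM2r ?invr_gt0 // ler_ln ?posrE // (lt_le_trans x0).
Qed.

Lemma log2_powR (x : R) : log2 (2 `^ x) = x.
Proof.
have ln2 : ln 2 != 0 :> R by rewrite gt_eqF // ln_gt0 // ltr1n.
by rewrite /log2 ln_powR mulfK.
Qed.

Lemma exists_pow2_between (y : R) : 1 <= y -> exists m, y <= 2 ^+ m /\ 2 ^+ m <= 2 * y.
Proof.
move=> y1; have exm : exists m, y <= 2 ^+ m.
  exists (Num.truncn y).+1; apply: le_trans (ltW (truncnS_gt y)) _.
  by rewrite -natrX ler_nat ltnW // ltn_expl.
case: (ex_minnP exm) => -[|m] hm min_m; first by exists 0%N; split=> //; rewrite expr0; lra.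
exists m.+1; split => //; rewrite exprS ler_pM2l //.
by rewrite leNgt; apply/negP => /ltW /min_m; rewrite ltnn.
Qed.

End Achievability.

Theorem theorem4p16 (R : realType) :
  exists f : R -> R,
    f =O_ ((0 : R)^'+) (fun d : R => log2 d^-1) /\
    forall (dA dE : nat) (rho : 'M[R[i]]_(dA * dE)) (delta eps : R),
      state rho -> 0 < delta -> delta <= eps ->
      exists d2 : nat,
        catalytic_decoupling rho eps d2 /\
        log2 (d2%:R : R) <=
          1 / 2 * (smooth_Imax (eps - delta) rho
                   + loglog_pos (smooth_Imax (eps - delta) rho)) + f delta.
Proof.
exists (@log_overhead R); split; first exact: log_overhead_bigO.
move=> dA dE rho delta eps srho d0 de.
have e0 : 0 <= eps - delta by rewrite subr_ge0.
have S0 := smooth_Imax_ge0 srho e0; set S := smooth_Imax _ _ in S0 *.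
have L0 : 0 <= loglog_pos S by rewrite /loglog_pos; case: ifP => // _; rewrite le_max lexx orbT.
have f2 : 2 + log2 delta^-1 <= log_overhead delta by rewrite lerD2l le_max lexx orbT.
have f0 : 2 <= log_overhead delta by rewrite lerDl le_max lexx.
have [eps1|eps1] := lerP 1 eps.
  exists 1%N; split; first exact: catalytic_decoupling_trivial.
  by rewrite /log2 ln1 mul0r; lra.
have d1 : delta < 1 by exact: le_lt_trans eps1.
(* Solves [2^(S + 1) = delta^2 y^2], the condition for error [delta] with [y] in the role of
   [2^m]. *)
pose y := 2 `^ ((S + 1) / 2) / delta.
have y1 : 1 <= y.
  rewrite ler_pdivlMr // mul1r (le_trans (ltW d1)) // -[leLHS](powRr0 2).
  by rewrite ler_powR ?ler1n //; lra.
have [m [ym my]] := exists_pow2_between y1; exists (2 ^ m)%N; split.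
  rewrite -(subrK delta eps); apply: catalytic_decoupling_smooth => //; [lra|exact: ltW|].
  rewrite -/S -exprMn (_ : S + 1 = (S + 1) / 2 + (S + 1) / 2); last by lra.
  rewrite powRD ?pnatr_eq0 ?implybT // -expr2.
  rewrite ler_pXn2r ?nnegrE ?powR_ge0 ?mulr_ge0 ?exprn_ge0 // ?(ltW d0) //.
  by rewrite [leRHS]mulrC -ler_pdivrMr.
have y0 : 0 < y by exact: lt_le_trans ltr01 y1.
have log22 : log2 2 = 1 :> R by rewrite -[2 in LHS]powRr1 ?log2_powR.
(* Yields [m <= 1 + (S + 1) / 2 + log (1 / delta)]. *)
have := ler_log2 (exprn_gt0 m (ltr0Sn _ 1)) my.
rewrite log2M // [log2 y]log2M ?powR_gt0 ?invr_gt0 // log2_powR log22.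
rewrite natrX; lra.
Qed.
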